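(* Let $0=t_0<t_1<\dots<t_k=\tau<T$, let $\theta=((e^0)^\top,\bar e^\top)^\top\in\mathbb R^{2d}$ be the true value of the common initial errors, and let $\hat\theta$ be the major agent's profile maximum-likelihood estimator of $\theta$ from the samples $\mathcal X_{t_0}^0,\dots,\mathcal X_{t_k}^0$, as defined in the context. Assume $\Sigma_s^0\succ0$ for $s=0,\dots,k-1$, $\mathcal I_{\eta\eta}^{(k)}\succ0$, and $$\mathcal I_{0,\mathrm{eff}}^{(k)}(\tau):=\mathcal I_{\theta\theta}^{(k)}-\mathcal I_{\theta\eta}^{(k)}\big(\mathcal I_{\eta\eta}^{(k)}\big)^{-1}\mathcal I_{\eta\theta}^{(k)}\succ0.$$ Then $$\hat\theta-\theta\sim\mathcal N\Big(0,\big(\mathcal I_{0,\mathrm{eff}}^{(k)}(\tau)\big)^{-1}\Big).$$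
   Context: **Parameters.** $T>0$; $A,F,D\in\mathbb R^{d\times d}$, $G\in\mathbb R^{d\times d_0}$, $B\in\mathbb R^{d\times m}$, $A_0,D_0\in\mathbb R^{d_0\times d_0}$, $F_0\in\mathbb R^{d_0\times d}$, $B_0\in\mathbb R^{d_0\times m_0}$; symmetric $Q,\bar Q\in\mathbb R^{d\times d}$, $Q_0,\bar Q_0\in\mathbb R^{d_0\times d_0}$ positive semidefinite; $R\in\mathbb R^{m\times m}$, $R_0\in\mathbb R^{m_0\times m_0}$ symmetric positive definite; $\Gamma,\bar\Gamma\in\mathbb R^{d\times d}$, $\Lambda,\bar\Lambda\in\mathbb R^{d\times d_0}$, $\Gamma_0,\bar\Gamma_0\in\mathbb R^{d_0\times d}$, and vectors $\eta_c,\bar\eta_c\in\mathbb R^d$, $\eta_0,\bar\eta_0\in\mathbb R^{d_0}$. Set $M:=BR^{-1}B^\top$, $M_0:=B_0R_0^{-1}B_0^\top$, $\Pi_0:=(I_{d_0},-\Gamma_0)$, $\bar\Pi_0:=(I_{d_0},-\bar\Gamma_0)$. **Riccati data.** Let $$A_1=\begin{pmatrix}A_0&F_0\\ G&A+F\end{pmatrix},\ \mathbb A=\begin{pmatrix}A_0&F_0&0\\ G&A+F&0\\ 0&0&A\end{pmatrix},\ \mathbb M=\begin{pmatrix}M_0&0&0\\ 0&0&M\end{pmatrix},$$ $$\mathcal Q=\begin{pmatrix}Q_0&-Q_0\Gamma_0\\ -\Gamma_0^\top Q_0&\Gamma_0^\top Q_0\Gamma_0\\ -Q\Lambda&-Q(\Gamma-I_d)\end{pmatrix},\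 \bar{\mathcal Q}=\begin{pmatrix}\bar Q_0&-\bar Q_0\bar\Gamma_0\\ -\bar\Gamma_0^\top\bar Q_0&\bar\Gamma_0^\top\bar Q_0\bar\Gamma_0\\ -\bar Q\bar\Lambda&-\bar Q(\bar\Gamma-I_d)\end{pmatrix},\ \nu=\begin{pmatrix}\Pi_0^\top Q_0\eta_0\\ Q\eta_c\end{pmatrix},\ \bar\nu=\begin{pmatrix}\bar\Pi_0^\top\bar Q_0\bar\eta_0\\ \bar Q\bar\eta_c\end{pmatrix}.$$ $P_t\in\mathbb R^{(d_0+2d)\times(d_0+d)}$, $\mathcal G_t\in\mathbb R^{d_0+2d}$, $P_t^x\in\mathbb R^{d\times d}$ solve on $[0,T]$ $$-\dot P_t=\mathbb A^\top P_t+P_tA_1-P_t\mathbb MP_t+\mathcal Q,\ P_T=\bar{\mathcal Q};\qquad \dot{\mathcal G}_t=-\big((\mathbb A^\top-P_t\mathbb M)\mathcal G_t-\nu\big),\ \mathcal G_T=-\bar\nu;$$ $$-\dot P_t^x=A^\top P_t^x+P_t^xA-P_t^xMP_t^x+Q,\ P_T^x=\bar Q.$$ Standing assumption: the Riccati equations for $P$ and $P^x$ have unique solutions on $[0,T]$. Partition $P_t=(P_t^{ab})_{a=1,2,3;\,b=1,2}$, $\mathcal G_t=(\mathcal G_t^a)_{a=1,2,3}$ with row block sizes $d_0,d,d$ and column block sizes $d_0,d$. **Propagators.** With $A_t^{22}:=A+F-MP_t^{32}$, $A_t^{44}:=A+F-MP_t^x$, $$\mathbb A_t^0=\begin{pmatrix}A_0-M_0P_t^{11}&-M_0P_t^{12}&0&F_0\\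 G-MP_t^{31}&A_t^{22}&0&0\\ G-MP_t^{31}&0&A_t^{22}&0\\ G-MP_t^{31}&0&-M(P_t^{32}-P_t^x)&A_t^{44}\end{pmatrix},$$ $\Phi_t=(\Phi_t^{ab})_{1\le a,b\le4}$ (block sizes $d_0,d,d,d$) solves $\dot\Phi_t=\mathbb A_t^0\Phi_t$, $\Phi_0=I_{3d+d_0}$; $\Phi_t^x$ solves $\dot\Phi_t^x=A_t^{22}\Phi_t^x$, $\Phi_0^x=I_d$; $\mathcal M_t^0=\int_0^t(\Phi_s^x)^{-1}(G-MP_s^{31})\Phi_s^{12}ds$, $\bar{\mathcal M}_t=\int_0^t(\Phi_s^x)^{-1}(G-MP_s^{31})\Phi_s^{13}ds$. **Observed process.** The major agent observes the minor agents with indices $\mathcal I_{obs}=\{j_1,\dots,j_q\}$. $W^0$ ($d_0$-dimensional) and $W^{j_1},\dots,W^{j_q}$ ($d$-dimensional) are independent Brownian motions. $\mathcal X_t^0=((X_t^0)^\top,(X_t^{j_1})^\top,\dots,(X_t^{j_q})^\top,(z_t^0)^\top)^\top$ (major state, observed minor states, mean field state internally updated by the major agent) starts from the given value $(x_0^0,x_0^{j_1},\dots,x_0^{j_q},z_0+e^0)$; $\mathcal E^0=((e^0)^\top,(\mathcal E^{obs})^\top,\bar e^\top)^\top\in\mathbb R^{(q+2)d}$ with $\mathcal E^{obs}=((e^{j_1})^\top,\dots,(e^{j_q})^\top)^\top$ is the unknown constant vector of initial-information errors; $\mathbb W_t^0=((W_t^0)^\top,(W_t^{j_1})^\top,\dots,(W_t^{j_q})^\top)^\top$;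 and $$d\mathcal X_t^0=(\mathbb A_t^2\mathcal X_t^0+\beta_t^0)dt-\mathbb K_t^0\mathcal E^0dt+\mathbb D^0d\mathbb W_t^0.$$ With $I^q=(I_d,\dots,I_d)^\top\in\mathbb R^{qd\times d}$, $$\mathbb A_t^2=\begin{pmatrix}A_0-M_0P_t^{11}&0&F_0-M_0P_t^{12}\\ I^q(G-MP_t^{31})&\mathrm{diag}(a_t^1,\dots,a_t^1)&I^q(F-M(P_t^{32}-P_t^x))\\ G-MP_t^{31}&0&A_t^{22}\end{pmatrix},\ \beta_t^0=\begin{pmatrix}-M_0\mathcal G_t^1\\ -I^qM\mathcal G_t^3\\ -M\mathcal G_t^3\end{pmatrix},$$ $$\mathbb D^0=\begin{pmatrix}D_0&0\\ 0&\mathrm{diag}(D,\dots,D)\\ 0&0\end{pmatrix},\ \mathbb K_t^0=\begin{pmatrix}F_0(\Phi_t^{22}-\Phi_t^{42})&0&F_0(\Phi_t^{23}-\Phi_t^{43})\\ I^q\mathcal K_t^1&\mathrm{diag}(k_t^1,\dots,k_t^1)&I^q\bar{\mathcal K}_t^1\\ 0&0&0\end{pmatrix},$$ ($q$ diagonal blocks each), $a_t^1=A-MP_t^x$, $k_t^1=M(P_t^{32}-P_t^x)\Phi_t^x$, $$\mathcal K_t^1=(F-M(P_t^{32}-P_t^x))\Phi_t^{22}-F\Phi_t^{42}+M(P_t^{32}-P_t^x)\Phi_t^x\mathcal M_t^0,$$ $$\bar{\mathcal K}_t^1=(F-M(P_t^{32}-P_t^x))\Phi_t^{23}-F\Phi_t^{43}+M(P_t^{32}-P_t^x)\Phi_t^x\bar{\mathcal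 M}_t.$$ $\Psi_t$ solves $\dot\Psi_t=\mathbb A_t^2\Psi_t$, $\Psi_0=I_{(q+1)d+d_0}$. **Likelihood and information matrices.** For $0\le s\le k-1$ put $$F_s^0(x)=\Psi_{t_{s+1}}\Psi_{t_s}^{-1}x+\Psi_{t_{s+1}}\int_{t_s}^{t_{s+1}}\Psi_u^{-1}\beta_u^0du,\quad H_s^0=\Psi_{t_{s+1}}\int_{t_s}^{t_{s+1}}\Psi_u^{-1}\mathbb K_u^0du,$$ $$\Sigma_s^0=\Psi_{t_{s+1}}\int_{t_s}^{t_{s+1}}\Psi_u^{-1}\mathbb D^0(\mathbb D^0)^\top\Psi_u^{-\top}du\,\Psi_{t_{s+1}}^\top.$$ The log-likelihood of a parameter value $\mathcal E\in\mathbb R^{(q+2)d}$ is $\ell_0(\mathcal E)=\sum_{s=0}^{k-1}\log\mathcal T_s^0(\mathcal X_{t_{s+1}}^0|\mathcal X_{t_s}^0;\mathcal E)$, where $\mathcal T_s^0(\cdot|x;\mathcal E)$ is the density of $\mathcal N(F_s^0(x)-H_s^0\mathcal E,\Sigma_s^0)$. The nuisance parameter is $\eta:=\mathcal E^{obs}$; the profile log-likelihood is $\ell_p^0(e^0,\bar e)=\sup_{\mathcal E^{obs}\in\mathbb R^{qd}}\ell_0(e^0,\mathcal E^{obs},\bar e)$, and $\hat\theta=\arg\max_{(e^0,\bar e)\in\mathbb R^d\times\mathbb R^d}\ell_p^0(e^0,\bar e)$. Further, $$\mathcal I_0^{(k)}(\tau)=\sum_{s=0}^{k-1}(H_s^0)^\top(\Sigma_s^0)^{-1}H_s^0,\quad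 S_\theta=\begin{pmatrix}I_d&0&0\\ 0&0&I_d\end{pmatrix},\quad S_\eta=\begin{pmatrix}0&I_{qd}&0\end{pmatrix}$$ (column block sizes $d,qd,d$), and $\mathcal I_{\theta\theta}^{(k)}=S_\theta\mathcal I_0^{(k)}(\tau)S_\theta^\top$, $\mathcal I_{\eta\eta}^{(k)}=S_\eta\mathcal I_0^{(k)}(\tau)S_\eta^\top$, $\mathcal I_{\theta\eta}^{(k)}=S_\theta\mathcal I_0^{(k)}(\tau)S_\eta^\top$, $\mathcal I_{\eta\theta}^{(k)}=(\mathcal I_{\theta\eta}^{(k)})^\top$. $\succ0$ means positive definite. *)

(* Defs.v *)
From HB Require Import structures.
From mathcomp Require Import all_boot all_order all_algebra.
From mathcomp Require Import all_classical all_reals all_analysis.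

Set Implicit Arguments.
Unset Strict Implicit.
Unset Printing Implicit Defensive.

Import Order.TTheory GRing.Theory Num.Theory.
Import numFieldNormedType.Exports.

Local Open Scope classical_set_scope.
Local Open Scope ring_scope.

(* Block rows and columns are nested to the left, so they match dimensions
   such as d0 + d + d = (d0 + d) + d. *)
Notation row3 a b c := (row_mx (row_mx a b) c).
Notation row4 a b c e := (row_mx (row3 a b c) e).
Notation col3 a b c := (col_mx (col_mx a b) c).
Notation col4 a b c e := (col_mx (col3 a b c) e).

Section Matrices.
Context {R : realType}.

Definition qform n (S : 'M[R]_n) (x : 'cV[R]_n) : R := (x^T *m S *m x) 0 0.

Definition possemidef n (S : 'M[R]_n) : Prop :=
  S^T = S /\ forall x : 'cV[R]_n, 0 <= qform S x.

Definition posdef n (S : 'M[R]_n) : Prop :=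
  S^T = S /\ forall x : 'cV[R]_n, x != 0 -> 0 < qform S x.

Definition mx_integral m n (a b : R) (f : R -> 'M[R]_(m, n)) : 'M[R]_(m, n) :=
  \matrix_(i, j) (\int[lebesgue_measure]_(u in `[a, b]) f u i j).

(* f' = rhs(t, f) on [0, T]. The equation is imposed on the open interval and f
   is continuous up to 0 and T; when rhs is continuous this gives the one-sided
   equations at 0 and T as well. *)
Definition solves_ode m n (T : R) (rhs : R -> 'M[R]_(m, n) -> 'M[R]_(m, n))
    (f : R -> 'M[R]_(m, n)) : Prop :=
  derivable_oo_LRcontinuous f 0 T /\
  {in `]0, T[, forall t, derive1 f t = rhs t (f t)}.

(* The Lebesgue density of N(mu, S) on R^n, for S positive definite. *)
Definition gauss_pdf n (mu : 'cV[R]_n) (S : 'M[R]_n) (x : 'cV[R]_n) : R :=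
  (Num.sqrt ((2 * pi) ^+ n * \det S))^-1 *
  expR (- (qform (invmx S) (x - mu) / 2)).

End Matrices.

Section Probability.
Context {R : realType} {disp : measure_display} {Om : measurableType disp}.
Variable Pr : probability Om R.

(* N(mu, v) on the line, parametrised by the variance v; N(mu, 0) is the Dirac
   mass at mu. *)
Definition normal_law (mu v : R) (B : set R) : \bar R :=
  if v == 0 then dirac mu B else normal_prob mu (Num.sqrt v) B.

Definition random_vector n (X : Om -> 'cV[R]_n) : Prop :=
  forall i, measurable_fun setT (fun w => X w i 0).

(* X ~ N(mu, V): every linear functional u^T X is N(u^T mu, u^T V u). *)
Definition gaussian_vector n (X : Om -> 'cV[R]_n) (mu : 'cV[R]_n)
    (V : 'M[R]_n) : Prop :=
  random_vector X /\
  forall (u : 'cV[R]_n) (B : set R), measurable B ->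
    Pr [set w | B ((u^T *m X w) 0 0)] =
    normal_law ((u^T *m mu) 0 0) (qform V u) B.

Definition sigma_vector n (X : Om -> 'cV[R]_n) : set (set Om) :=
  g_sigma_preimage (fun i w => X w i 0).

Definition sigma_process n (T : R) (W : R -> Om -> 'cV[R]_n) : set (set Om) :=
  <<s \bigcup_(t in `[0, T]) sigma_vector (W t) >>.

Definition mutually_independent (I : finType) (F : I -> set (set Om)) : Prop :=
  forall (J : {set I}) (A : I -> set Om), (forall i, F i (A i)) ->
    Pr (\bigcap_(i in [set` J]) A i) = (\prod_(i in J) Pr (A i))%E.

Definition brownian_motion n (T : R) (W : R -> Om -> 'cV[R]_n) : Prop :=
  [/\ {in `[0, T], forall t, random_vector (W t)},
      {ae Pr, forall w, W 0 w = 0 /\ {within `[0, T], continuous (W ^~ w)}},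
      forall s t : R, 0 <= s -> s < t -> t <= T ->
        gaussian_vector (fun w => W t w - W s w) 0 ((t - s)%:M)
    & forall (N : nat) (r : nat -> R),
        0 <= r 0%N -> (forall i, (i < N)%N -> r i <= r i.+1) -> r N <= T ->
        mutually_independent
          (fun i : 'I_N => sigma_vector (fun w => W (r i.+1) w - W (r i) w))].

End Probability.

Record params (R : realType) (d d0 m m0 : nat) := Params {
  A : 'M[R]_d;  F : 'M[R]_d;  D : 'M[R]_d;
  G : 'M[R]_(d, d0);  B : 'M[R]_(d, m);
  A0 : 'M[R]_d0;  D0 : 'M[R]_d0;
  F0 : 'M[R]_(d0, d);  B0 : 'M[R]_(d0, m0);
  Q : 'M[R]_d;  Qbar : 'M[R]_d;
  Q0 : 'M[R]_d0;  Q0bar : 'M[R]_d0;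
  Rm : 'M[R]_m;  R0 : 'M[R]_m0;
  Gamma : 'M[R]_d;  Gammabar : 'M[R]_d;
  Lambda : 'M[R]_(d, d0);  Lambdabar : 'M[R]_(d, d0);
  Gamma0 : 'M[R]_(d0, d);  Gamma0bar : 'M[R]_(d0, d);
  etac : 'cV[R]_d;  etacbar : 'cV[R]_d;
  eta0 : 'cV[R]_d0;  eta0bar : 'cV[R]_d0 }.

Definition admissible (R : realType) (d d0 m m0 : nat)
    (p : params R d d0 m m0) : Prop :=
  [/\ possemidef (Q p), possemidef (Qbar p), possemidef (Q0 p)
    & possemidef (Q0bar p)] /\ (posdef (Rm p) /\ posdef (R0 p)).

Section Riccati.
Context {R : realType} {d d0 m m0 : nat}.
Variables (T : R) (p : params R d d0 m m0).

Definition M : 'M[R]_d := B p *m invmx (Rm p) *m (B p)^T.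
Definition M0 : 'M[R]_d0 := B0 p *m invmx (R0 p) *m (B0 p)^T.
Definition Pi0 : 'M[R]_(d0, d0 + d) := row_mx 1%:M (- Gamma0 p).
Definition Pi0bar : 'M[R]_(d0, d0 + d) := row_mx 1%:M (- Gamma0bar p).

Definition A1 : 'M[R]_(d0 + d) := block_mx (A0 p) (F0 p) (G p) (A p + F p).

Definition AA : 'M[R]_(d0 + d + d) :=
  col3 (row3 (A0 p) (F0 p) 0) (row3 (G p) (A p + F p) 0) (row3 0 0 (A p)).

Definition MM : 'M[R]_(d0 + d, d0 + d + d) :=
  col_mx (row3 M0 0 0) (row3 0 0 M).

Definition QQ : 'M[R]_(d0 + d + d, d0 + d) :=
  col3 (row_mx (Q0 p) (- (Q0 p *m Gamma0 p)))
       (row_mx (- ((Gamma0 p)^T *m Q0 p)) ((Gamma0 p)^T *m Q0 p *m Gamma0 p))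
       (row_mx (- (Q p *m Lambda p)) (- (Q p *m (Gamma p - 1%:M)))).

Definition QQbar : 'M[R]_(d0 + d + d, d0 + d) :=
  col3 (row_mx (Q0bar p) (- (Q0bar p *m Gamma0bar p)))
       (row_mx (- ((Gamma0bar p)^T *m Q0bar p))
               ((Gamma0bar p)^T *m Q0bar p *m Gamma0bar p))
       (row_mx (- (Qbar p *m Lambdabar p))
               (- (Qbar p *m (Gammabar p - 1%:M)))).

Definition nu : 'cV[R]_(d0 + d + d) :=
  col_mx (Pi0^T *m Q0 p *m eta0 p) (Q p *m etac p).
Definition nubar : 'cV[R]_(d0 + d + d) :=
  col_mx (Pi0bar^T *m Q0bar p *m eta0bar p) (Qbar p *m etacbar p).

Definition riccati_P (P : R -> 'M[R]_(d0 + d + d, d0 + d)) : Prop :=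
  solves_ode T (fun _ P => - (AA^T *m P + P *m A1 - P *m MM *m P + QQ)) P /\
  P T = QQbar.

Definition riccati_Px (Px : R -> 'M[R]_d) : Prop :=
  solves_ode T
    (fun _ Px => - ((A p)^T *m Px + Px *m A p - Px *m M *m Px + Q p)) Px /\
  Px T = Qbar p.

Definition solves_GG (P : R -> 'M[R]_(d0 + d + d, d0 + d))
    (GG : R -> 'cV[R]_(d0 + d + d)) : Prop :=
  solves_ode T (fun t g => - ((AA^T - P t *m MM) *m g - nu)) GG /\
  GG T = - nubar.

End Riccati.

Section Blocks.
Context {R : realType} {d d0 : nat}.

Definition P11 (P : 'M[R]_(d0 + d + d, d0 + d)) : 'M[R]_d0 :=
  ulsubmx (usubmx P).
Definition P12 (P : 'M[R]_(d0 + d + d, d0 + d)) : 'M[R]_(d0, d) :=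
  ursubmx (usubmx P).
Definition P31 (P : 'M[R]_(d0 + d + d, d0 + d)) : 'M[R]_(d, d0) :=
  lsubmx (dsubmx P).
Definition P32 (P : 'M[R]_(d0 + d + d, d0 + d)) : 'M[R]_d :=
  rsubmx (dsubmx P).

Definition GG1 (g : 'cV[R]_(d0 + d + d)) : 'cV[R]_d0 := usubmx (usubmx g).
Definition GG3 (g : 'cV[R]_(d0 + d + d)) : 'cV[R]_d := dsubmx g.

Definition Phi12 (X : 'M[R]_(d0 + d + d + d)) : 'M[R]_(d0, d) :=
  ursubmx (ulsubmx (ulsubmx X)).
Definition Phi13 (X : 'M[R]_(d0 + d + d + d)) : 'M[R]_(d0, d) :=
  usubmx (ursubmx (ulsubmx X)).
Definition Phi22 (X : 'M[R]_(d0 + d + d + d)) : 'M[R]_d :=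
  drsubmx (ulsubmx (ulsubmx X)).
Definition Phi23 (X : 'M[R]_(d0 + d + d + d)) : 'M[R]_d :=
  dsubmx (ursubmx (ulsubmx X)).
Definition Phi42 (X : 'M[R]_(d0 + d + d + d)) : 'M[R]_d :=
  rsubmx (lsubmx (dlsubmx X)).
Definition Phi43 (X : 'M[R]_(d0 + d + d + d)) : 'M[R]_d :=
  rsubmx (dlsubmx X).

End Blocks.

(* The functions of time that the model defines through differential equations,
   q being the number of observed minor agents. Stacking q copies of R^d gives
   dimension \sum_(i < q) d, as in the library's \mxcol and \mxdiag. *)
Record curves (R : realType) (d d0 q : nat) := Curves {
  cP : R -> 'M[R]_(d0 + d + d, d0 + d);
  cGG : R -> 'cV[R]_(d0 + d + d);
  cPx : R -> 'M[R]_d;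
  cPhi : R -> 'M[R]_(d0 + d + d + d);
  cPhix : R -> 'M[R]_d;
  cPsi : R -> 'M[R]_(d0 + \sum_(i < q) d + d) }.

Section Observation.
Context {R : realType} {d d0 m m0 q : nat}.
Variables (p : params R d d0 m m0) (c : curves R d d0 q).

Local Notation M := (M p).
Local Notation M0 := (M0 p).
Local Notation dq := (\sum_(i < q) d)%N.

Definition A22 (t : R) : 'M[R]_d := A p + F p - M *m P32 (cP c t).
Definition A44 (t : R) : 'M[R]_d := A p + F p - M *m cPx c t.
Definition GMP31 (t : R) : 'M[R]_(d, d0) := G p - M *m P31 (cP c t).
Definition MPdiff (t : R) : 'M[R]_d := M *m (P32 (cP c t) - cPx c t).

Definition AA0 (t : R) : 'M[R]_(d0 + d + d + d) :=
  col4
    (row4 (A0 p - M0 *m P11 (cP c t)) (- (M0 *m P12 (cP c t))) 0 (F0 p))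
    (row4 (GMP31 t) (A22 t) 0 0)
    (row4 (GMP31 t) 0 (A22 t) 0)
    (row4 (GMP31 t) 0 (- MPdiff t) (A44 t)).

Definition MM0 (t : R) : 'M[R]_d :=
  mx_integral 0 t
    (fun s => invmx (cPhix c s) *m GMP31 s *m Phi12 (cPhi c s)).
Definition MMbar (t : R) : 'M[R]_d :=
  mx_integral 0 t
    (fun s => invmx (cPhix c s) *m GMP31 s *m Phi13 (cPhi c s)).

Definition Iq : 'M[R]_(dq, d) := \mxcol_(i < q) (1%:M : 'M[R]_d).
Definition diagq (a : 'M[R]_d) : 'M[R]_dq := \mxdiag_(i < q) a.

Definition a1 (t : R) : 'M[R]_d := A p - M *m cPx c t.
Definition k1 (t : R) : 'M[R]_d := MPdiff t *m cPhix c t.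

Definition K1 (t : R) : 'M[R]_d :=
  (F p - MPdiff t) *m Phi22 (cPhi c t) - F p *m Phi42 (cPhi c t)
  + MPdiff t *m cPhix c t *m MM0 t.
Definition K1bar (t : R) : 'M[R]_d :=
  (F p - MPdiff t) *m Phi23 (cPhi c t) - F p *m Phi43 (cPhi c t)
  + MPdiff t *m cPhix c t *m MMbar t.

Definition AA2 (t : R) : 'M[R]_(d0 + dq + d) :=
  col3
    (row3 (A0 p - M0 *m P11 (cP c t)) 0 (F0 p - M0 *m P12 (cP c t)))
    (row3 (Iq *m GMP31 t) (diagq (a1 t)) (Iq *m (F p - MPdiff t)))
    (row3 (GMP31 t) 0 (A22 t)).

Definition beta0 (t : R) : 'cV[R]_(d0 + dq + d) :=
  col3 (- (M0 *m GG1 (cGG c t)))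
       (- (Iq *m M *m GG3 (cGG c t)))
       (- (M *m GG3 (cGG c t))).

Definition DD0 : 'M[R]_(d0 + dq + d, d0 + dq) :=
  col3 (row_mx (D0 p) 0) (row_mx 0 (diagq (D p))) (row_mx 0 0).

Definition KK0 (t : R) : 'M[R]_(d0 + dq + d, d + dq + d) :=
  col3
    (row3 (F0 p *m (Phi22 (cPhi c t) - Phi42 (cPhi c t))) 0
          (F0 p *m (Phi23 (cPhi c t) - Phi43 (cPhi c t))))
    (row3 (Iq *m K1 t) (diagq (k1 t)) (Iq *m K1bar t))
    (row3 0 0 0).

Definition solves_Phi (T : R) : Prop :=
  solves_ode T (fun t X => AA0 t *m X) (cPhi c) /\ cPhi c 0 = 1%:M.
Definition solves_Phix (T : R) : Prop :=
  solves_ode T (fun t X => A22 t *m X) (cPhix c) /\ cPhix c 0 = 1%:M.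
Definition solves_Psi (T : R) : Prop :=
  solves_ode T (fun t X => AA2 t *m X) (cPsi c) /\ cPsi c 0 = 1%:M.

(* The linear equation dX = (A2 X + beta) dt - K E dt + DD0 dW, X_0 = x0, on
   [0, T]. The diffusion coefficient DD0 is constant, so that the stochastic
   integral is DD0 (W_t - W_0) and the integral form of the equation is
   pathwise. *)
Definition observed_process {disp : measure_display} {Om : measurableType disp}
    (Pr : probability Om R) (T : R) (E : 'cV[R]_(d + dq + d))
    (x0 : 'cV[R]_(d0 + dq + d)) (W : R -> Om -> 'cV[R]_(d0 + dq))
    (X : R -> Om -> 'cV[R]_(d0 + dq + d)) : Prop :=
  {in `[0, T], forall t, random_vector (X t)} /\
  {ae Pr, forall w,
    {within `[0, T], continuous (X ^~ w)} /\
    {in `[0, T], forall t,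
      X t w = x0
        + mx_integral 0 t (fun s => AA2 s *m X s w + beta0 s - KK0 s *m E)
        + DD0 *m (W t w - W 0 w)}}.

Section Likelihood.
Variables (k : nat) (t : nat -> R).

Definition Fs (s : nat) (x : 'cV[R]_(d0 + dq + d)) : 'cV[R]_(d0 + dq + d) :=
  cPsi c (t s.+1) *m invmx (cPsi c (t s)) *m x
  + cPsi c (t s.+1)
    *m mx_integral (t s) (t s.+1) (fun u => invmx (cPsi c u) *m beta0 u).

Definition Hs (s : nat) : 'M[R]_(d0 + dq + d, d + dq + d) :=
  cPsi c (t s.+1)
  *m mx_integral (t s) (t s.+1) (fun u => invmx (cPsi c u) *m KK0 u).

Definition Sigmas (s : nat) : 'M[R]_(d0 + dq + d) :=
  cPsi c (t s.+1)
  *m mx_integral (t s) (t s.+1)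
       (fun u => invmx (cPsi c u) *m DD0 *m DD0^T *m (invmx (cPsi c u))^T)
  *m (cPsi c (t s.+1))^T.

Definition transition (s : nat) (E : 'cV[R]_(d + dq + d))
    (x y : 'cV[R]_(d0 + dq + d)) : R :=
  gauss_pdf (Fs s x - Hs s *m E) (Sigmas s) y.

(* x s is the sample taken at time t s *)
Definition loglik (x : nat -> 'cV[R]_(d0 + dq + d)) (E : 'cV[R]_(d + dq + d))
    : R :=
  \sum_(s < k) ln (transition s E (x s) (x s.+1)).

Definition profile_loglik (x : nat -> 'cV[R]_(d0 + dq + d))
    (th : 'cV[R]_(d + d)) : \bar R :=
  ereal_sup
    [set (loglik x (col3 (usubmx th) Eobs (dsubmx th)))%:E
       | Eobs in [set: 'cV[R]_dq]].

(* A maximiser of the profile log-likelihood (and 0 if there is none). *)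
Definition profile_mle (x : nat -> 'cV[R]_(d0 + dq + d)) : 'cV[R]_(d + d) :=
  xget 0 [set th | forall th' : 'cV[R]_(d + d),
                     (profile_loglik x th' <= profile_loglik x th)%E].

Definition info : 'M[R]_(d + dq + d) :=
  \sum_(s < k) (Hs s)^T *m invmx (Sigmas s) *m Hs s.

Definition Stheta : 'M[R]_(d + d, d + dq + d) :=
  col_mx (row3 1%:M 0 0) (row3 0 0 1%:M).
Definition Seta : 'M[R]_(dq, d + dq + d) := row3 0 1%:M 0.

Definition info_tt : 'M[R]_(d + d) := Stheta *m info *m Stheta^T.
Definition info_ee : 'M[R]_dq := Seta *m info *m Seta^T.
Definition info_te : 'M[R]_(d + d, dq) := Stheta *m info *m Seta^T.
Definition info_et : 'M[R]_(dq, d + d) := info_te^T.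

Definition info_eff : 'M[R]_(d + d) :=
  info_tt - info_te *m invmx info_ee *m info_et.

End Likelihood.

End Observation.

(* Main.v *)
(* Along the process, the vector X_{s+1} - F_s(X_s) + H_s E equals
   Psi_{s+1} int Psi_u^-1 D0 dW_u over [t_s, t_{s+1}]. The integrand is
   deterministic and differentiable, so integrating by parts pathwise exhibits
   any linear functional of it as the almost sure limit of Riemann sums of
   Brownian increments; these are centred normal with convergent variances, so
   the limit is centred normal with variance given by Sigma_s, jointly over s.
   Up to a constant the log-likelihood is the quadratic E^T b - E^T I E / 2 with
   b the score at 0, so completing the square gives the estimator
   Ieff^-1 L b with L = S_theta - I_te I_ee^-1 S_eta. Since L I E = Ieff theta,
   the error is a linear function of the noise vectors, with variance
   Ieff^-1 (L I L^T) Ieff^-1 = Ieff^-1. *)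
Require Import Defs.
From mathcomp Require Import all_boot all_order all_algebra.
From mathcomp Require Import all_classical all_reals all_analysis.
From mathcomp Require Import measurable_realfun ring lra.

Set Implicit Arguments.
Unset Strict Implicit.
Unset Printing Implicit Defensive.

Import Order.TTheory GRing.Theory Num.Theory.
Import numFieldNormedType.Exports.

Local Open Scope classical_set_scope.
Local Open Scope ring_scope.

(** * Integrals and Riemann sums on a segment *)

(** Normality of a vector is expressed through all its linear functionals, so the probabilistic work
    concerns real variables only. Three obstacles shape the proof. Zero variances occur, for the
    zero functional and for increments whose weight vanishes; every centred normal law is therefore
    handled as the law of [sqrt v * Z] with [Z] standard normal, which includes the Dirac mass. Sums
    of independent normals come from convolving densities, and limits from dominated convergence
    along those representations. Finally, integration by parts needs [Psi] to be invertible on all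
    of [0, T] with a differentiable inverse; invertibility comes from an energy estimate run
    backwards in time, and differentiability from Cramer's rule. The joint law over the observation
    steps is obtained by refining all steps into one partition, so that independence is only ever
    used for Brownian increments and for the different agents. *)

Section SegmentIntegrals.
Context {R : realType}.
Implicit Types (a b x y : R) (f g h : R -> R).

Definition cont_on a b f : Prop := {within `[a, b], continuous f}.
Definition segint a b f : R := \int[lebesgue_measure]_(x in `[a, b]) f x.

Lemma cont_onS a b x y f : a <= x -> y <= b -> cont_on a b f -> cont_on x y f.
Proof.
move=> ax yb; apply: continuous_subspaceW => z /=; rewrite !in_itv/= => /andP[xz zy].
by rewrite (le_trans ax)//= (le_trans zy).
Qed.

Lemma cont_on_cst a b (c : R) : cont_on a b (fun=> c).
Proof. by apply: continuous_subspaceT => z; exact: cvg_cst. Qed.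

Lemma cont_onD a b f g : cont_on a b f -> cont_on a b g -> cont_on a b (fun u => f u + g u).
Proof. move=> cf cg z; apply: continuousD; [exact: cf|exact: cg]. Qed.

Lemma cont_onN a b f : cont_on a b f -> cont_on a b (fun u => - f u).
Proof. move=> cf z; apply: continuousN; exact: cf. Qed.

Lemma cont_onB a b f g : cont_on a b f -> cont_on a b g -> cont_on a b (fun u => f u - g u).
Proof. by move=> cf cg; apply: cont_onD => //; exact: cont_onN. Qed.

Lemma cont_onM a b f g : cont_on a b f -> cont_on a b g -> cont_on a b (fun u => f u * g u).
Proof. move=> cf cg z; apply: continuousM; [exact: cf|exact: cg]. Qed.

Lemma cont_on_sum a b (I : Type) (s : seq I) (f : I -> R -> R) :
  (forall i, cont_on a b (f i)) -> cont_on a b (fun u => \sum_(i <- s) f i u).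
Proof.
move=> cf; elim: s => [|i s IH].
  by under eq_fun do rewrite big_nil; exact: cont_on_cst.
by under eq_fun do rewrite big_cons; exact: cont_onD.
Qed.

Lemma cont_on_prod a b (I : Type) (s : seq I) (f : I -> R -> R) :
  (forall i, cont_on a b (f i)) -> cont_on a b (fun u => \prod_(i <- s) f i u).
Proof.
move=> cf; elim: s => [|i s IH].
  by under eq_fun do rewrite big_nil; exact: cont_on_cst.
by under eq_fun do rewrite big_cons; exact: cont_onM.
Qed.

Lemma cont_on_ext a b f g : {in `[a, b], f =1 g} -> cont_on a b f -> cont_on a b g.
Proof.
move=> fg /subspace_continuousP cf; apply/subspace_continuousP => z zab.
suff : g x @[x --> within `[a, b] (nbhs z)] --> f z by rewrite fg.
apply: cvg_trans (cf z zab); apply: near_eq_cvg.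
near=> y; apply: fg; near: y; exact: withinT.
Unshelve. all: by end_near. Qed.

Lemma cont_onV a b f : (forall u, u \in `[a, b] -> f u != 0) -> cont_on a b f ->
  cont_on a b (fun u => (f u)^-1).
Proof.
move=> f0 cf; apply/subspace_continuousP => z zab; apply: cvgV; first exact: f0.
by move/subspace_continuousP : cf; exact.
Qed.

Lemma cont_on_integrable a b f : cont_on a b f ->
  lebesgue_measure.-integrable `[a, b] (EFin \o f).
Proof. by move=> cf; apply: continuous_compact_integrable => //; exact: segment_compact. Qed.

Lemma cont_on_bounded a b f : cont_on a b f ->
  exists2 M, 0 <= M & forall u, a <= u <= b -> `|f u| <= M.
Proof.
move=> cf; have [ab|ba] := leP a b; last first.
  by exists 0 => // u /andP[au ub]; rewrite leNgt (lt_le_trans ba)// (le_trans au) in ub.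
have [c1 _ f1] := EVT_max ab cf.
have [c2 _ f2] := EVT_min ab cf.
exists (Num.max `|f c1| `|f c2|); first by rewrite le_max normr_ge0.
move=> u uab; have ui : u \in `[a, b] by rewrite in_itv.
have := f1 _ ui; have := f2 _ ui => h2 h1.
rewrite le_max; have [fu|fu] := ger0P (f u).
  by rewrite (le_trans h1) ?ler_norm.
by rewrite -(normrN (f c2)) (le_trans _ (ler_norm (- f c2))) ?orbT// lerN2.
Qed.

(** Compactness is used in its near-covering form with the radius, tending to 0 from the right, as
    parameter: radii valid near each point yield one radius valid on the segment. *)
Lemma heine a b f : cont_on a b f -> forall e : R, 0 < e ->
  exists2 dl : R, 0 < dl & forall x y, a <= x <= b -> a <= y <= b ->
    `|x - y| < dl -> `|f x - f y| < e.
Proof.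
move=> cf e e0.
have := (compact_near_coveringP _).1 (@segment_compact _ a b).
move=> /(_ R (0^'+) (fun dl x => a <= x <= b -> forall y, a <= y <= b -> `|x - y| < dl -> `|f x - f y| < e) _).
case=> [|dl /= dl0 H].
  move=> x /=; rewrite in_itv/= => xab.
  have /cvgrPdist_lt/(_ (e / 2)) := (subspace_continuousP _ _).1 cf x xab.
  rewrite divr_gt0// => /(_ isT); rewrite near_withinE => -[r /= r0 rP].
  have rP' z : a <= z <= b -> `|x - z| < r -> `|f x - f z| < e / 2.
    by move=> zab xz; apply: rP => //; rewrite in_itv.
  (* Halving [r] keeps both [z] and any [y] within [dl] of [z] inside the ball of radius [r] around
     [x]. *)
  exists (ball x (r / 2), [set dl | 0 < dl < r / 2]).
    split; first by apply: nbhsx_ballx; rewrite divr_gt0.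
    exists (r / 2); first by rewrite /= divr_gt0.
    by move=> z /=; rewrite sub0r normrN => zr z0; rewrite z0 (le_lt_trans (ler_norm _)).
  move=> [z dl] [/= xz /andP[dl0 dlr]] zab y yab zy.
  have xz2 : `|x - z| < r by rewrite (lt_trans xz)// ltr_pdivrMr// ltr_pMr// ltr1n.
  have xy : `|x - y| < r.
    rewrite (splitr r) (le_lt_trans _ (ltrD xz (lt_trans zy dlr)))//.
    by rewrite -[in leLHS](subrK z x) -addrA ler_normD.
  rewrite (splitr e) (le_lt_trans _ (ltrD (rP' _ zab xz2) (rP' _ yab xy)))//.
  by rewrite (distrC (f x) (f z)) -[in leLHS](subrK (f x) (f z)) -addrA ler_normD.
exists (dl / 2); first by rewrite divr_gt0.
move=> x y xab yab xy; apply: (H (dl / 2)) => //=.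
- by rewrite sub0r normrN gtr0_norm ?divr_gt0// ltr_pdivrMr// ltr_pMr// ltr1n.
- by rewrite divr_gt0.
Qed.

Lemma segintD a b f g : cont_on a b f -> cont_on a b g ->
  segint a b (fun u => f u + g u) = segint a b f + segint a b g.
Proof. by move=> cf cg; apply: RintegralD => //; exact: cont_on_integrable. Qed.

Lemma segintB a b f g : cont_on a b f -> cont_on a b g ->
  segint a b (fun u => f u - g u) = segint a b f - segint a b g.
Proof. by move=> cf cg; apply: RintegralB => //; exact: cont_on_integrable. Qed.

Lemma segintZ a b (c : R) f : cont_on a b f -> segint a b (fun u => c * f u) = c * segint a b f.
Proof. by move=> cf; apply: RintegralZl => //; exact: cont_on_integrable. Qed.

Lemma segint_ext a b f g : (forall u, a <= u <= b -> f u = g u) -> segint a b f = segint a b g.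
Proof. by move=> fg; apply: eq_Rintegral => u; rewrite inE/= in_itv/=; exact: fg. Qed.

Lemma segint_cst a b (c : R) : a <= b -> segint a b (fun=> c) = c * (b - a).
Proof.
move=> ab; rewrite /segint Rintegral_cst//= lebesgue_measure_itv/= lte_fin.
by move: ab; rewrite le_eqVlt => /predU1P[->|->]; rewrite ?ltxx ?subrr.
Qed.

Lemma segint0 a b : segint a b (fun=> 0) = 0.
Proof. by rewrite /segint Rintegral_cst//= mul0r. Qed.

Lemma segint_sum a b (I : Type) (s : seq I) (f : I -> R -> R) :
  (forall i, cont_on a b (f i)) ->
  segint a b (fun u => \sum_(i <- s) f i u) = \sum_(i <- s) segint a b (f i).
Proof.
move=> cf; elim: s => [|i s IH].
  by under [in LHS]eq_fun do rewrite big_nil; rewrite big_nil segint0.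
under [in LHS]eq_fun do rewrite big_cons.
by rewrite big_cons segintD ?IH//; exact: cont_on_sum.
Qed.

Lemma segintxx a f : segint a a f = 0.
Proof. by rewrite /segint set_itv1 Rintegral_set1. Qed.

Lemma segint_chasles a x b f : a <= x <= b -> cont_on a b f ->
  segint a b f = segint a x f + segint x b f.
Proof.
move=> /andP[ax xb] cf; apply/eqP; rewrite addrC -subr_eq; apply/eqP.
rewrite /segint Rintegral_itvB//; last by exact: cont_on_integrable.
rewrite Rintegral_itv_obnd_cbnd//.
apply: integrableS (cont_on_integrable cf) => //; apply: subset_itvr.
by rewrite bnd_simp.
Qed.

Lemma le_norm_segint a b f (M : R) : a <= b -> cont_on a b f ->
  (forall u, a <= u <= b -> `|f u| <= M) -> `|segint a b f| <= M * (b - a).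
Proof.
move=> ab cf fM; rewrite -segint_cst//.
apply: (le_trans (le_normr_Rintegral _ (cont_on_integrable cf))) => //.
apply: le_Rintegral => //.
- apply: (@cont_on_integrable a b (fun u => `|f u|)) => z; apply: continuous_comp; first exact: cf.
  exact: norm_continuous.
- exact: cont_on_integrable (@cont_on_cst a b M).
Qed.

Lemma segint_partition (u : nat -> R) n f :
  (forall i, (i < n)%N -> u i <= u i.+1) -> cont_on (u 0%N) (u n) f ->
  segint (u 0%N) (u n) f = \sum_(i < n) segint (u i) (u i.+1) f.
Proof.
elim: n => [_ _|n IH uS cf]; first by rewrite big_ord0 segintxx.
have u0n : u 0%N <= u n.
  have : (n <= n)%N by []; elim: {1 3}n => // m IHm mn.
  by rewrite (le_trans (IHm (ltnW mn)))// uS// ltnS ltnW.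
rewrite (@segint_chasles _ (u n))//; last by rewrite u0n uS.
rewrite big_ord_recr/= IH//; first by move=> i iN; apply: uS; rewrite ltnS ltnW.
by apply: cont_onS cf => //; exact: uS.
Qed.

Definition grid a b (n i : nat) : R := a + (b - a) * (i%:R / n%:R).

Lemma grid0 a b n : grid a b n 0 = a.
Proof. by rewrite /grid mul0r mulr0 addr0. Qed.

Lemma gridn a b n : grid a b n.+1 n.+1 = b.
Proof. by rewrite /grid divff ?pnatr_eq0// mulr1 addrC subrK. Qed.

Lemma grid_step a b n i : grid a b n i.+1 - grid a b n i = (b - a) / n%:R.
Proof. by rewrite /grid opprD addrACA subrr add0r -mulrBr -mulrBl -natrB// subSnn mul1r. Qed.

Lemma grid_lt a b n i : a < b -> grid a b n.+1 i < grid a b n.+1 i.+1.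
Proof. by move=> ab; rewrite -subr_gt0 grid_step divr_gt0 ?subr_gt0. Qed.

Lemma grid_itv a b n i : a <= b -> (i <= n.+1)%N -> a <= grid a b n.+1 i <= b.
Proof.
move=> ab iN; rewrite /grid lerDl mulr_ge0 ?subr_ge0//=.
rewrite -lerBrDl ler_piMr ?subr_ge0// ler_pdivrMr// mul1r ler_nat//.
Qed.

Lemma segint_grid a b n f : a <= b -> cont_on a b f ->
  segint a b f = \sum_(i < n.+1) segint (grid a b n.+1 i) (grid a b n.+1 i.+1) f.
Proof.
move=> ab cf; rewrite -segint_partition ?grid0 ?gridn//.
by move=> i _; rewrite -subr_ge0 grid_step divr_ge0 ?subr_ge0.
Qed.

(** The cells have total length [b - a], so an integrand that is uniformly small on every cell
    contributes a small total. *)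
Lemma grid_error a b (phi : nat -> nat -> R -> R) : a <= b ->
  (forall n i, (i < n.+1)%N -> cont_on (grid a b n.+1 i) (grid a b n.+1 i.+1) (phi n i)) ->
  (forall e : R, 0 < e -> \forall n \near \oo, forall i u, (i < n.+1)%N ->
     grid a b n.+1 i <= u <= grid a b n.+1 i.+1 -> `|phi n i u| <= e) ->
  \sum_(i < n.+1) segint (grid a b n.+1 i) (grid a b n.+1 i.+1) (phi n i) @[n --> \oo] --> (0 : R).
Proof.
move=> ab cphi sphi; apply/cvgrPdist_le => e e0.
(* The added 1 keeps the denominator positive when [a = b]. *)
have e'0 : 0 < e / (b - a + 1) by rewrite divr_gt0// ltr_wpDl// subr_ge0.
near=> n; rewrite sub0r normrN (le_trans (ler_norm_sum _ _ _))//.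
apply: (@le_trans _ _ (\sum_(i < n.+1) e / (b - a + 1) * ((b - a) / n.+1%:R))).
  apply: ler_sum => i _; rewrite -(grid_step a b n.+1 i).
  apply: le_norm_segint.
  - by rewrite -subr_ge0 grid_step divr_ge0 ?subr_ge0.
  - exact: cphi.
  - by move=> u; move: i u; near: n; apply: filterS (sphi _ e'0) => n H i u; exact: H.
rewrite sumr_const card_ord -[leLHS]mulr_natr -!mulrA mulVf ?pnatr_eq0// mulr1.
rewrite ger_pMr// mulrC ler_pdivrMr ?ltr_wpDl ?subr_ge0// mul1r lerDl//.
Unshelve. all: by end_near. Qed.

Lemma grid_mesh a b (dl : R) : 0 < dl -> \forall n \near \oo, (b - a) / n.+1%:R < dl.
Proof.
move=> dl0; near=> n; rewrite ltr_pdivrMr// mulrC -ltr_pdivrMr//.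
rewrite (@lt_trans _ _ n%:R) ?ltr_nat//.
by near: n; exact: nbhs_infty_gtr.
Unshelve. all: by end_near. Qed.

(** Uniform continuity of [f] and boundedness of [g] make the integrand uniformly small. The tag is
    left free because the integration by parts below freezes one factor at the left end of each cell
    and the other at the right end. *)
Lemma tagged_error a b g f (c : nat -> nat -> R) : a <= b -> cont_on a b g -> cont_on a b f ->
  (forall n i, grid a b n.+1 i <= c n i <= grid a b n.+1 i.+1) ->
  \sum_(i < n.+1) segint (grid a b n.+1 i) (grid a b n.+1 i.+1)
    (fun u => g u * (f u - f (c n i))) @[n --> \oo] --> (0 : R).
Proof.
move=> ab cg cf cP; apply: (@grid_error a b (fun n i u => g u * (f u - f (c n i)))) => // [n i iN|e e0].
  have /andP[ai _] := @grid_itv _ _ n i ab (ltnW iN).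
  have /andP[_ ib] := @grid_itv _ _ n i.+1 ab iN.
  apply: cont_onM; first exact: cont_onS cg.
  by apply: cont_onB; [exact: cont_onS cf|exact: cont_on_cst].
have [M M0 gM] := cont_on_bounded cg.
have e'0 : 0 < e / (M + 1) by rewrite divr_gt0// ltr_wpDl.
have [dl dl0 fdl] := heine cf e'0.
apply: filterS (grid_mesh a b dl0) => n ndl i u iN /andP[iu ui].
have /andP[ai _] := @grid_itv _ _ n i ab (ltnW iN).
have /andP[_ ib] := @grid_itv _ _ n i.+1 ab iN.
have /andP[ic ci] := cP n i.
have uab : a <= u <= b by rewrite (le_trans ai)//= (le_trans ui).
have cab : a <= c n i <= b by rewrite (le_trans ai)//= (le_trans ci).
rewrite normrM; apply: (@le_trans _ _ (M * (e / (M + 1)))).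
  apply: ler_pM => //; first exact: gM.
  apply/ltW/fdl => //; apply: le_lt_trans ndl; rewrite -(grid_step a b n.+1 i).
  by rewrite ler_norml; apply/andP; split; lra.
by rewrite mulrCA ger_pMr// ler_pdivrMr ?ltr_wpDl// mul1r lerDl.
Qed.

Lemma riemann_sum a b f : a <= b -> cont_on a b f ->
  \sum_(i < n.+1) (grid a b n.+1 i.+1 - grid a b n.+1 i) * f (grid a b n.+1 i)
    @[n --> \oo] --> segint a b f.
Proof.
move=> ab cf.
have gS n i : grid a b n.+1 i <= grid a b n.+1 i.+1.
  by rewrite -subr_ge0 grid_step divr_ge0 ?subr_ge0.
have gS' n i : grid a b n.+1 i <= grid a b n.+1 i <= grid a b n.+1 i.+1 by rewrite lexx gS.
have H := @tagged_error a b (fun=> 1) f (fun n i => grid a b n.+1 i) ab (@cont_on_cst _ _ _) cf gS'.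
have -> : (fun n => \sum_(i < n.+1) (grid a b n.+1 i.+1 - grid a b n.+1 i) * f (grid a b n.+1 i)) =
  (fun n => segint a b f - \sum_(i < n.+1) segint (grid a b n.+1 i) (grid a b n.+1 i.+1)
    (fun u => 1 * (f u - f (grid a b n.+1 i)))).
  apply/funext => n; rewrite (segint_grid n ab cf) -sumrB; apply: eq_bigr => i _.
  have /andP[ai _] := @grid_itv _ _ n i ab (ltnW (ltn_ord i)).
  have /andP[_ ib] := @grid_itv _ _ n i.+1 ab (ltn_ord i).
  rewrite [in RHS](@segint_ext _ _ (fun u => 1 * (f u - f (grid a b n.+1 i)))
    (fun u => f u - f (grid a b n.+1 i))); last by move=> u _; rewrite mul1r.
  rewrite segintB ?segint_cst//; [by rewrite subKr mulrC| |exact: cont_on_cst].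
  exact: cont_onS cf.
by rewrite -[X in _ --> X]subr0; apply: cvgB => //; exact: cvg_cst.
Qed.

(* The Wiener integral of p against w as a limit of Riemann sums, written
   without w by integrating by parts. *)
Lemma wiener_sum_by_parts a b (p g X h w : R -> R) : a <= b ->
  cont_on a b p -> cont_on a b g -> cont_on a b X -> cont_on a b h ->
  (forall x y, a <= x -> x <= y -> y <= b -> p y - p x = - segint x y g) ->
  (forall x y, a <= x -> x <= y -> y <= b -> X y - X x = segint x y h + (w y - w x)) ->
  \sum_(i < n.+1) p (grid a b n.+1 i) * (w (grid a b n.+1 i.+1) - w (grid a b n.+1 i))
    @[n --> \oo] --> p b * X b - p a * X a - segint a b (fun u => p u * h u - g u * X u).
Proof.
move=> ab cp cg cX ch pE XE.
have gS n i : grid a b n.+1 i <= grid a b n.+1 i.+1.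
  by rewrite -subr_ge0 grid_step divr_ge0 ?subr_ge0.
have H1 : \sum_(i < n.+1) segint (grid a b n.+1 i) (grid a b n.+1 i.+1)
    (fun u => h u * (p u - p (grid a b n.+1 i))) @[n --> \oo] --> (0 : R).
  by apply: (@tagged_error a b h p (fun n i => grid a b n.+1 i)) => // n i; rewrite lexx gS.
have H2 : \sum_(i < n.+1) segint (grid a b n.+1 i) (grid a b n.+1 i.+1)
    (fun u => g u * (X u - X (grid a b n.+1 i.+1))) @[n --> \oo] --> (0 : R).
  by apply: (@tagged_error a b g X (fun n i => grid a b n.+1 i.+1)) => // n i; rewrite lexx gS.
set L := (X in _ --> X).
suff -> : (fun n => \sum_(i < n.+1) p (grid a b n.+1 i) *
      (w (grid a b n.+1 i.+1) - w (grid a b n.+1 i))) =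
  (fun n => L + (\sum_(i < n.+1) segint (grid a b n.+1 i) (grid a b n.+1 i.+1)
      (fun u => h u * (p u - p (grid a b n.+1 i))) -
    \sum_(i < n.+1) segint (grid a b n.+1 i) (grid a b n.+1 i.+1)
      (fun u => g u * (X u - X (grid a b n.+1 i.+1))))).
  rewrite -[X in _ --> X]addr0; apply: cvgD; first exact: cvg_cst.
  by rewrite -[X in _ --> X](subr0 0); apply: cvgB.
apply/funext => n; rewrite /L (@segint_grid _ _ n)//; last by apply: cont_onB; exact: cont_onM.
have -> : p b * X b - p a * X a = \sum_(i < n.+1) (p (grid a b n.+1 i.+1) * X (grid a b n.+1 i.+1)
    - p (grid a b n.+1 i) * X (grid a b n.+1 i)).
  rewrite -(big_mkord xpredT (fun i => p (grid a b n.+1 i.+1) * X (grid a b n.+1 i.+1)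
    - p (grid a b n.+1 i) * X (grid a b n.+1 i))).
  by rewrite (telescope_sumr (fun i => p (grid a b n.+1 i) * X (grid a b n.+1 i)))// gridn grid0.
rewrite -!sumrB -big_split; apply: eq_bigr => i _ /=.
have /andP[ai _] := @grid_itv _ _ n i ab (ltnW (ltn_ord i)).
have /andP[_ ib] := @grid_itv _ _ n i.+1 ab (ltn_ord i).
have := gS n i; have := XE _ _ ai (gS n i) ib; have := pE _ _ ai (gS n i) ib.
(* What remains is an identity on one cell [x, y]: summation by parts turns [p x * (w y - w x)] into
   the boundary term and the integral, up to the errors of freezing [p] at [x] and [X] at [y]. *)
move: ai ib; move: (grid _ _ _ i) (grid _ _ _ i.+1) => x y ax yb pxy Xxy xy.
have S f : cont_on a b f -> cont_on x y f by apply: cont_onS.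
have {}cp := S _ cp; have {}cg := S _ cg; have {}cX := S _ cX; have {}ch := S _ ch.
have -> : segint x y (fun u => h u * (p u - p x)) = segint x y (fun u => p u * h u) - p x * segint x y h.
  rewrite -segintZ// -segintB; [|exact: cont_onM|by apply: cont_onM => //; exact: cont_on_cst].
  by apply: segint_ext => u _; ring.
have -> : segint x y (fun u => g u * (X u - X y)) = segint x y (fun u => g u * X u) - X y * segint x y g.
  rewrite -segintZ// -segintB; [|exact: cont_onM|by apply: cont_onM => //; exact: cont_on_cst].
  by apply: segint_ext => u _; ring.
rewrite segintB; [|exact: cont_onM|exact: cont_onM].
have -> : segint x y g = p x - p y by rewrite -[RHS]opprB pxy opprK.
have -> : w y - w x = X y - X x - segint x y h by rewrite Xxy addrAC subrr add0r.
ring.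
Qed.

End SegmentIntegrals.

(** * Matrix-valued curves and linear differential equations *)

Section MatrixCurves.
Context {R : realType}.

(** Entrywise, to match [mx_integral], and restricted to a segment because the curves are controlled
    only on [0, T]. *)
Definition mcont m n (a b : R) (f : R -> 'M[R]_(m, n)) : Prop :=
  forall i j, cont_on a b (fun u => f u i j).

Lemma mcontS m n a b x y (f : R -> 'M[R]_(m, n)) : a <= x -> y <= b -> mcont a b f -> mcont x y f.
Proof. by move=> ax yb cf i j; exact: cont_onS (cf i j). Qed.

Lemma mcont_cst m n a b (C : 'M[R]_(m, n)) : mcont a b (fun=> C).
Proof. by move=> i j; exact: cont_on_cst. Qed.

Lemma mcont_eq m n a b (f : R -> 'M[R]_(m, n)) (F : 'I_m -> 'I_n -> R -> R) :
  (forall u i j, f u i j = F i j u) -> (forall i j, cont_on a b (F i j)) -> mcont a b f.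
Proof. by move=> fF cF i j; rewrite (_ : (fun u => _) = F i j)//; apply/funext => u; exact: fF. Qed.

Lemma mcontD m n a b (f g : R -> 'M[R]_(m, n)) :
  mcont a b f -> mcont a b g -> mcont a b (fun u => f u + g u).
Proof.
by move=> cf cg; apply: mcont_eq => [u i j|i j]; [rewrite mxE|apply: cont_onD; [exact: cf|exact: cg]].
Qed.

Lemma mcontN m n a b (f : R -> 'M[R]_(m, n)) : mcont a b f -> mcont a b (fun u => - f u).
Proof.
by move=> cf; apply: mcont_eq => [u i j|i j]; [rewrite mxE|apply: cont_onN; exact: cf].
Qed.

Lemma mcontB m n a b (f g : R -> 'M[R]_(m, n)) :
  mcont a b f -> mcont a b g -> mcont a b (fun u => f u - g u).
Proof. by move=> cf cg; apply: mcontD => //; exact: mcontN. Qed.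

Lemma mcontM m n p a b (f : R -> 'M[R]_(m, n)) (g : R -> 'M[R]_(n, p)) :
  mcont a b f -> mcont a b g -> mcont a b (fun u => f u *m g u).
Proof.
move=> cf cg; apply: mcont_eq => [u i j|i j]; first by rewrite mxE.
by apply: cont_on_sum => k; apply: cont_onM; [exact: cf|exact: cg].
Qed.

Lemma mcont_tr m n a b (f : R -> 'M[R]_(m, n)) : mcont a b f -> mcont a b (fun u => (f u)^T).
Proof. by move=> cf; apply: mcont_eq => [u i j|i j]; [rewrite mxE|exact: cf]. Qed.

Lemma mcont_row m n p a b (f : R -> 'M[R]_(m, n)) (g : R -> 'M[R]_(m, p)) :
  mcont a b f -> mcont a b g -> mcont a b (fun u => row_mx (f u) (g u)).
Proof.
move=> cf cg i j; case: (split_ordP j) => k ->.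
  by under eq_fun do rewrite row_mxEl; exact: cf.
by under eq_fun do rewrite row_mxEr; exact: cg.
Qed.

Lemma mcont_col m n p a b (f : R -> 'M[R]_(m, n)) (g : R -> 'M[R]_(p, n)) :
  mcont a b f -> mcont a b g -> mcont a b (fun u => col_mx (f u) (g u)).
Proof.
move=> cf cg i j; case: (split_ordP i) => k ->.
  by under eq_fun do rewrite col_mxEu; exact: cf.
by under eq_fun do rewrite col_mxEd; exact: cg.
Qed.

Lemma mcont_lsub m n p a b (f : R -> 'M[R]_(m, n + p)) :
  mcont a b f -> mcont a b (fun u => lsubmx (f u)).
Proof.
by move=> cf; apply: (@mcont_eq _ _ _ _ _ (fun i j u => f u i (lshift p j))) => [u i j|i j];
  [rewrite mxE|exact: cf].
Qed.

Lemma mcont_rsub m n p a b (f : R -> 'M[R]_(m, n + p)) :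
  mcont a b f -> mcont a b (fun u => rsubmx (f u)).
Proof.
by move=> cf; apply: (@mcont_eq _ _ _ _ _ (fun i j u => f u i (rshift n j))) => [u i j|i j];
  [rewrite mxE|exact: cf].
Qed.

Lemma mcont_usub m n p a b (f : R -> 'M[R]_(m + p, n)) :
  mcont a b f -> mcont a b (fun u => usubmx (f u)).
Proof.
by move=> cf; apply: (@mcont_eq _ _ _ _ _ (fun i j u => f u (lshift p i) j)) => [u i j|i j];
  [rewrite mxE|exact: cf].
Qed.

Lemma mcont_dsub m n p a b (f : R -> 'M[R]_(m + p, n)) :
  mcont a b f -> mcont a b (fun u => dsubmx (f u)).
Proof.
by move=> cf; apply: (@mcont_eq _ _ _ _ _ (fun i j u => f u (rshift m i) j)) => [u i j|i j];
  [rewrite mxE|exact: cf].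
Qed.

Lemma mcont_mxdiag q d a b (f : R -> 'M[R]_d) : mcont a b f ->
  mcont a b (fun u => \mxdiag_(i < q) f u).
Proof.
move=> cf i j; pose i' := tagnat.sig1 i; pose j' := tagnat.sig1 j.
rewrite (_ : (fun u => _) = (fun u => (if i' == j' then f u else 0) (tagnat.sig2 i) (tagnat.sig2 j))); last first.
  apply/funext => u; rewrite !mxE -/i' -/j'; case: eqVneq => // _.
  by rewrite conform_mx_id.
case: eqVneq => _; first exact: cf.
by rewrite (_ : (fun u => _) = (fun=> 0)); [exact: cont_on_cst|apply/funext => u; rewrite mxE].
Qed.

Lemma cont_on_det n a b (f : R -> 'M[R]_n) : mcont a b f -> cont_on a b (fun u => \det (f u)).
Proof.
move=> cf; apply: cont_on_sum => s; apply: cont_onM; first exact: cont_on_cst.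
by apply: cont_on_prod => i; exact: cf.
Qed.

(** Cramer's rule expresses the entries through determinants. The formula agrees with [invmx] only
    at invertible matrices, hence the comparison on the segment alone. *)
Lemma mcont_inv n a b (f : R -> 'M[R]_n) : mcont a b f ->
  (forall u, a <= u <= b -> f u \in unitmx) -> mcont a b (fun u => invmx (f u)).
Proof.
move=> cf uf i j.
apply: (@cont_on_ext _ a b (fun u => (\det (f u))^-1 * cofactor (f u) j i)).
  by move=> u uab; rewrite /invmx uf ?inE// !mxE.
apply: cont_onM.
  apply: cont_onV; last exact: cont_on_det.
  by move=> u uab; have := uf u uab; rewrite unitmxE unitfE.
apply: cont_onM; first exact: cont_on_cst.
apply: cont_on_det; apply: (@mcont_eq _ _ _ _ _ (fun k l u => f u (lift j k) (lift i l))) => [u k l|k l].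
  by rewrite !mxE.
exact: cf.
Qed.

Lemma mx_integralE m n a b (f : R -> 'M[R]_(m, n)) i j :
  mx_integral a b f i j = segint a b (fun u => f u i j).
Proof. by rewrite mxE. Qed.

Lemma mx_integral_ext m n a b (f g : R -> 'M[R]_(m, n)) :
  (forall u, a <= u <= b -> f u = g u) -> mx_integral a b f = mx_integral a b g.
Proof.
by move=> fg; apply/matrixP => i j; rewrite !mx_integralE; apply: segint_ext => u uab; rewrite fg.
Qed.

Lemma mx_integralD m n a b (f g : R -> 'M[R]_(m, n)) : mcont a b f -> mcont a b g ->
  mx_integral a b (fun u => f u + g u) = mx_integral a b f + mx_integral a b g.
Proof.
move=> cf cg; apply/matrixP => i j; rewrite [RHS]mxE !mx_integralE -segintD//.
by apply: segint_ext => u _; rewrite mxE.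
Qed.

Lemma mx_integralB m n a b (f g : R -> 'M[R]_(m, n)) : mcont a b f -> mcont a b g ->
  mx_integral a b (fun u => f u - g u) = mx_integral a b f - mx_integral a b g.
Proof.
move=> cf cg; apply/matrixP => i j; rewrite [RHS]mxE [X in _ = _ + X]mxE !mx_integralE -segintB//.
by apply: segint_ext => u _; rewrite mxE [X in _ + X]mxE.
Qed.

Lemma mx_integralMl m n p a b (C : 'M[R]_(m, n)) (f : R -> 'M[R]_(n, p)) : mcont a b f ->
  C *m mx_integral a b f = mx_integral a b (fun u => C *m f u).
Proof.
move=> cf; apply/matrixP => i j; rewrite mxE mx_integralE.
under eq_bigr do rewrite mx_integralE -segintZ//.
rewrite -segint_sum; last by move=> k; apply: cont_onM => //; exact: cont_on_cst.
by apply: segint_ext => u _; rewrite mxE.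
Qed.

Lemma mx_integral_tr m n a b (f : R -> 'M[R]_(m, n)) :
  (mx_integral a b f)^T = mx_integral a b (fun u => (f u)^T).
Proof.
by apply/matrixP => i j; rewrite mxE !mx_integralE; apply: segint_ext => u _; rewrite mxE.
Qed.

Lemma mx_integralMr m n p a b (C : 'M[R]_(n, p)) (f : R -> 'M[R]_(m, n)) : mcont a b f ->
  mx_integral a b f *m C = mx_integral a b (fun u => f u *m C).
Proof.
move=> cf; apply: trmx_inj; rewrite trmx_mul !mx_integral_tr mx_integralMl; last exact: mcont_tr.
by apply: mx_integral_ext => u _; rewrite trmx_mul.
Qed.

Lemma mx_integral_chasles m n a x b (f : R -> 'M[R]_(m, n)) : a <= x <= b -> mcont a b f ->
  mx_integral a b f = mx_integral a x f + mx_integral x b f.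
Proof.
by move=> axb cf; apply/matrixP => i j; rewrite [RHS]mxE !mx_integralE; exact: segint_chasles.
Qed.

Lemma cont_on_primitive a b (f : R -> R) : a <= b -> cont_on a b f ->
  cont_on a b (fun t => segint a t f).
Proof.
by move=> ab cf; apply: parameterized_integral_continuous => //; exact: cont_on_integrable.
Qed.

Lemma mcont_primitive m n a b (f : R -> 'M[R]_(m, n)) : a <= b -> mcont a b f ->
  mcont a b (fun t => mx_integral a t f).
Proof.
move=> ab cf; apply: mcont_eq => [u i j|i j]; first by rewrite mx_integralE.
exact: cont_on_primitive.
Qed.

Lemma within_mcont m n a b (f : R -> 'M[R]_(m, n)) : {within `[a, b], continuous f} -> mcont a b f.
Proof.
move=> cf i j z.
apply: (@continuous_comp (subspace `[a, b]) _ _ f (fun M : 'M[R]_(m, n) => M i j)); first exact: cf.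
exact: coord_continuous.
Qed.

Lemma ode_mcont m n T rhs (f : R -> 'M[R]_(m, n)) : solves_ode T rhs f -> mcont 0 T f.
Proof. by move=> [/derivable_oo_LRcontinuous_within cf _]; exact: within_mcont. Qed.

Lemma ode_is_derive m n T rhs (f : R -> 'M[R]_(m, n)) : solves_ode T rhs f ->
  forall t, 0 < t < T -> forall i j, is_derive t 1 (fun u => f u i j) (rhs t (f t) i j).
Proof.
move=> [[df _ _] fE] t tT i j.
have dft : derivable f t 1 by apply: df; rewrite in_itv.
have := fE t; rewrite in_itv/= => /(_ tT); rewrite derive1E derive_mx// => <-.
by rewrite mxE; apply/derivableP; move/derivable_mxP : dft.
Qed.

Lemma FTC (f F : R -> R) a b : a <= b -> cont_on a b f -> cont_on a b F ->
  (forall t, a < t < b -> is_derive t 1 F (f t)) -> F b - F a = segint a b f.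
Proof.
rewrite le_eqVlt => /predU1P[<-|ab]; first by rewrite segintxx subrr.
move=> cf cF dF; rewrite /segint /Rintegral.
rewrite (@continuous_FTC2 _ f F _ _ ab cf) //.
  have /(continuous_within_itvP _ ab)[_ ? ?] := cF; split => // t.
  by rewrite in_itv/= => /dF dFt; exact: (@ex_derive _ _ _ _ _ _ _ dFt).
by move=> t; rewrite in_itv/= => /dF; rewrite derive1E => ?; exact: derive_val.
Qed.

(* The witness is expR (2 C n t) |y t|^2, which is nondecreasing. *)
Lemma linear_ode_backward n (s C : R) (y : 'I_n -> R -> R) (a : R -> 'M[R]_n) :
  0 <= s -> 0 <= C -> (forall i, cont_on 0 s (y i)) ->
  (forall t, 0 < t < s -> forall i, is_derive t 1 (y i) (\sum_j a t i j * y j t)) ->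
  (forall t, 0 < t < s -> forall i j, `|a t i j| <= C) ->
  (forall i, y i s = 0) -> forall i, y i 0 = 0.
Proof.
rewrite le_eqVlt => /predU1P[<-//|s0] C0 cy dy aC ys.
(* Since 2|xy| is at most x^2 + y^2, the derivative of [N] is at least [- K * N]; this rate makes
   [E] nondecreasing. *)
pose K := 2 * C * n%:R.
pose N t := \sum_i (y i t) ^+ 2.
pose E t := expR (K * t) * N t.
pose N' t := \sum_i (2 * y i t * (\sum_j a t i j * y j t)).
have dN t : 0 < t < s -> is_derive t 1 N (N' t).
  move=> ts; have -> : N = \sum_i (fun u => (y i u) ^+ 2).
    by apply/funext => u; rewrite fct_sumE.
  apply: is_derive_sum => i; have := dy t ts i => di.
  have -> : (fun u => (y i u) ^+ 2) = y i * y i by apply/funext => u; rewrite expr2.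
  by apply: (is_derive_eq (is_deriveM di di)); rewrite /GRing.scale/=; ring.
have dE t : 0 < t < s -> is_derive t 1 E (expR (K * t) * (K * N t + N' t)).
  move=> ts; have := dN t ts => dNt.
  have dexp : is_derive t 1 (fun u => expR (K * u)) (K * expR (K * t)).
    have dK : is_derive t 1 ( *%R K) K.
      by apply: (is_derive_eq (is_deriveZ K (is_derive_id t 1))); rewrite /GRing.scale/= mulr1.
    by apply: (is_derive_eq (is_derive1_comp (is_derive_expR (K * t)) dK)); rewrite mulrC.
  apply: (is_derive_eq (is_deriveM dexp dNt)).
  by rewrite /GRing.scale/=; ring.
have cE : cont_on 0 s E.
  apply: cont_onM; last by apply: cont_on_sum => i; apply: cont_onM; exact: cy.
  apply: continuous_subspaceT => z; apply: continuous_comp; last exact: continuous_expR.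
  by apply: continuousM; [exact: cvg_cst|exact: cvg_id].
have E'0 t : 0 < t < s -> 0 <= expR (K * t) * (K * N t + N' t).
  move=> ts; rewrite mulr_ge0 ?expR_ge0//.
  (* Spreading [K * N] over pairs of indices allows a term-by-term comparison with [N']. *)
  have -> : K * N t = \sum_i \sum_j C * ((y i t) ^+ 2 + (y j t) ^+ 2).
    transitivity (C * (\sum_(i < n) \sum_(j < n) (y i t) ^+ 2 + \sum_(i < n) \sum_(j < n) (y j t) ^+ 2)).
      rewrite sumr_const card_ord exchange_big /= sumr_const card_ord /K -/(N t).
      by rewrite -[N t *+ n]mulr_natl; ring.
    rewrite -big_split mulr_sumr; apply: eq_bigr => i _ /=.
    by rewrite -big_split mulr_sumr; apply: eq_bigr.
  rewrite -big_split sumr_ge0// => i _ /=; rewrite mulr_sumr -big_split sumr_ge0// => j _ /=.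
  have := aC t ts i j; rewrite ler_norml => /andP[a1 a2].
  have sq1 := sqr_ge0 (y i t + y j t); have sq2 := sqr_ge0 (y i t - y j t).
  nra.
have Ele : E 0 <= E s.
  apply: (@ger0_derive1_le_cc _ E 0 s).
  - by move=> t; rewrite in_itv/= => ts; have dEt := dE t ts; exact: (@ex_derive _ _ _ _ _ _ _ dEt).
  - by move=> t; rewrite in_itv/= => ts; rewrite derive1E (@derive_val _ _ _ _ _ _ _ (dE t ts)) E'0.
  - exact: cE.
  - by rewrite in_itv/= lexx ltW.
  - by rewrite in_itv/= lexx ltW.
  - exact: ltW.
have Ns : N s = 0 by rewrite /N big1// => i _; rewrite ys expr0n.
have N0 : N 0 = 0.
  apply/eqP; rewrite eq_le sumr_ge0 ?andbT => [|i _]; last exact: sqr_ge0.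
  by move: Ele; rewrite /E Ns mulr0 mulr0 expR0 mul1r.
move=> i; apply/eqP; rewrite -sqrf_eq0; move/eqP : N0.
rewrite psumr_eq0 => [/allP/(_ i)|j _]; last exact: sqr_ge0.
by rewrite mem_index_enum => /(_ isT).
Qed.

(* A kernel vector of Phi s would start a nonzero solution of x' = A x that
   vanishes at s. *)
Lemma fundamental_unit n T (A : R -> 'M[R]_n) (Phi : R -> 'M[R]_n) :
  mcont 0 T A -> solves_ode T (fun t X => A t *m X) Phi -> Phi 0 = 1%:M ->
  forall s, 0 <= s <= T -> Phi s \in unitmx.
Proof.
move=> cA oPhi Phi0 s /andP[s0 sT].
rewrite unitmxE unitfE -det_tr; apply/negP => /det0P[v v0 vPhi].
have vPhi' : Phi s *m v^T = 0 by apply: trmx_inj; rewrite trmx_mul trmxK vPhi trmx0.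
have cPhi := ode_mcont oPhi.
have [C C0 AC] : exists2 C, 0 <= C & forall t, 0 < t < s -> forall i j, `|A t i j| <= C.
  have B i j := cont_on_bounded (cA i j).
  (* The sum of the bounds of all entries dominates each of them. *)
  exists (\sum_i \sum_j sval (cid2 (B i j))).
    by apply: sumr_ge0 => i _; apply: sumr_ge0 => j _; case: cid2.
  move=> t /andP[t0 ts] i j.
  apply: (@le_trans _ _ (sval (cid2 (B i j)))).
    by case: cid2 => /= M _; apply; rewrite (ltW t0) (le_trans (ltW ts)).
  rewrite (bigD1 i)//= (bigD1 j)//= -addrA lerDl addr_ge0//.
    by apply: sumr_ge0 => j' _; case: cid2.
  by apply: sumr_ge0 => i' _; apply: sumr_ge0 => j' _; case: cid2.
have H := @linear_ode_backward n s C (fun i t => (Phi t *m v^T) i 0) A s0 C0.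
have {}H : forall i, (Phi 0 *m v^T) i 0 = 0.
  apply: H => //.
  - have cPv : mcont 0 s (fun t => Phi t *m v^T).
      by apply: mcontM; [exact: mcontS cPhi|exact: mcont_cst].
    by move=> i; exact: cPv.
  - move=> t /andP[t0 ts] i.
    have tT : 0 < t < T by rewrite t0 (lt_le_trans ts).
    rewrite (_ : (fun t => _) = \sum_j (fun t => Phi t i j * v^T j 0)); last first.
      by apply/funext => u; rewrite mxE fct_sumE.
    have -> : \sum_j A t i j * (Phi t *m v^T) j 0 = \sum_j (A t *m Phi t) i j * v^T j 0.
      transitivity ((A t *m (Phi t *m v^T)) i 0); first by rewrite mxE.
      by rewrite mulmxA mxE.
    apply: is_derive_sum => j; have dij := ode_is_derive oPhi tT i j.
    apply: (is_derive_eq (is_deriveM dij (is_derive_cst (v^T j 0) t 1))).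
    by rewrite /GRing.scale/= mulr0 add0r mulrC.
  - by move=> i; rewrite vPhi' mxE.
move/eqP : v0; apply; apply/rowP => i; rewrite mxE.
by have := H i; rewrite Phi0 mul1mx mxE.
Qed.

Lemma derivable_sum_fun (I : Type) (s : seq I) (f : I -> R -> R) t :
  (forall i, derivable (f i) t 1) -> derivable (fun u => \sum_(i <- s) f i u) t 1.
Proof.
move=> df; elim: s => [|i s IH].
  by under eq_fun do rewrite big_nil; exact: derivable_cst.
by under eq_fun do rewrite big_cons; apply: (derivableD (df i) IH).
Qed.

Lemma derivable_prod_fun (I : Type) (s : seq I) (f : I -> R -> R) t :
  (forall i, derivable (f i) t 1) -> derivable (fun u => \prod_(i <- s) f i u) t 1.
Proof.
move=> df; elim: s => [|i s IH].
  by under eq_fun do rewrite big_nil; exact: derivable_cst.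
by under eq_fun do rewrite big_cons; apply: (derivableM (df i) IH).
Qed.

Lemma derivable_det n (f : R -> 'M[R]_n) t : (forall i j, derivable (fun u => f u i j) t 1) ->
  derivable (fun u => \det (f u)) t 1.
Proof.
move=> df; apply: derivable_sum_fun => s; apply: derivableM; first exact: derivable_cst.
by apply: derivable_prod_fun => i; exact: df.
Qed.

Lemma derivable_inv n (f : R -> 'M[R]_n) t : (forall i j, derivable (fun u => f u i j) t 1) ->
  (\forall u \near t, f u \in unitmx) ->
  forall i j, derivable (fun u => invmx (f u) i j) t 1.
Proof.
move=> df uf i j.
apply: (@near_eq_derivable _ _ _ (fun u => (\det (f u))^-1 * cofactor (f u) j i)).
  by apply: filterS uf => u ufu; rewrite /invmx ufu !mxE.
apply: derivableM.
  apply: derivableV; last exact: derivable_det.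
  by have := nbhs_singleton uf; rewrite unitmxE unitfE.
apply: derivableM; first exact: derivable_cst.
apply: derivable_det => k l; under eq_fun do rewrite !mxE.
exact: df.
Qed.

(** Differentiating the constant [invmx (Phi u) *m Phi u] shows that the inverse has derivative
    [- invmx Phi *m A]. The integral form holds up to the endpoints 0 and T, although the equation
    is imposed only between them. *)
Lemma fundamental_inv_integral n T (A : R -> 'M[R]_n) (Phi : R -> 'M[R]_n) :
  mcont 0 T A -> solves_ode T (fun t X => A t *m X) Phi -> Phi 0 = 1%:M ->
  forall x y, 0 <= x -> x <= y -> y <= T ->
  invmx (Phi y) - invmx (Phi x) = - mx_integral x y (fun u => invmx (Phi u) *m A u).
Proof.
move=> cA oPhi Phi0 x y x0 xy yT.
have uPhi := fundamental_unit cA oPhi Phi0.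
have cPhi := ode_mcont oPhi.
have cinv : mcont 0 T (fun u => invmx (Phi u)) by exact: mcont_inv.
have ciA : mcont 0 T (fun u => invmx (Phi u) *m A u) by exact: mcontM.
have ciAN : mcont 0 T (fun u => - (invmx (Phi u) *m A u)) by exact: mcontN.
have -> : - mx_integral x y (fun u => invmx (Phi u) *m A u) =
    mx_integral x y (fun u => - (invmx (Phi u) *m A u)).
  apply: oppr_inj; rewrite opprK; apply/eqP; rewrite -subr_eq0 opprK -mx_integralD; last 2 first.
    - exact: mcontS ciA.
    - exact: mcontS ciAN.
  apply/eqP/matrixP => i j; rewrite mx_integralE mxE -[RHS](segint0 x y).
  by apply: segint_ext => u _; rewrite subrr mxE.
apply/matrixP => i j; rewrite mx_integralE mxE [X in _ + X]mxE.
apply: (@FTC _ (fun u => invmx (Phi u) i j)) => //.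
- have c := ciAN i j; by apply: (@cont_onS _ 0 T) c.
- have c := cinv i j; by apply: (@cont_onS _ 0 T) c.
move=> t /andP[xt ty].
have tT : 0 < t < T by rewrite (le_lt_trans x0)//= (lt_le_trans ty).
have nu : \forall u \near t, Phi u \in unitmx.
  near=> u; apply: uPhi; apply/andP; split; apply: ltW; near: u.
    by apply: lt_nbhsr; case/andP: tT.
  by apply: lt_nbhsl; case/andP: tT.
have dPhi k l := ode_is_derive oPhi tT k l.
have dinv : forall k l, derivable (fun u => invmx (Phi u) k l) t 1.
  by apply: derivable_inv => // k l; have := dPhi k l; exact: ex_derive.
pose V := \matrix_(k, l) 'D_1 (fun u => invmx (Phi u) k l) t.
have VE : V *m Phi t + invmx (Phi t) *m (A t *m Phi t) = 0.
  apply/matrixP => k l; rewrite [RHS]mxE.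
  have d1 : is_derive t 1 (fun u => (invmx (Phi u) *m Phi u) k l)
      ((V *m Phi t + invmx (Phi t) *m (A t *m Phi t)) k l).
    rewrite (_ : (fun u => _) = \sum_r (fun u => invmx (Phi u) k r * Phi u r l)); last first.
      by apply/funext => u; rewrite mxE fct_sumE.
    have -> : (V *m Phi t + invmx (Phi t) *m (A t *m Phi t)) k l =
        \sum_r (V k r * Phi t r l + invmx (Phi t) k r * (A t *m Phi t) r l).
      by rewrite big_split /= [LHS]mxE; congr (_ + _); rewrite mxE.
    apply: is_derive_sum => r; have d2 := derivableP (dinv k r).
    apply: (is_derive_eq (is_deriveM d2 (dPhi r l))).
    by rewrite /GRing.scale/= [V k r]mxE; ring.
  have d0 : is_derive t 1 (fun u => (invmx (Phi u) *m Phi u) k l) 0.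
    have dc : is_derive t 1 (cst ((1%:M : 'M[R]_n) k l)) 0 by exact: is_derive_cst.
    apply: near_eq_is_derive dc.
    by apply: filterS nu => u uu; rewrite mulVmx.
  by rewrite -(@derive_val _ _ _ _ _ _ _ d1) (@derive_val _ _ _ _ _ _ _ d0).
have {}VE : V = - (invmx (Phi t) *m A t).
  have ut : Phi t \in unitmx by exact: nbhs_singleton nu.
  apply/eqP; rewrite -addr_eq0; apply/eqP.
  by rewrite -[LHS](mulmxK ut) mulmxDl -mulmxA VE mul0mx.
by rewrite -VE mxE; exact: derivableP.
Unshelve. all: by end_near. Qed.

End MatrixCurves.

(** * Normal laws on the line *)

Section NormalLaws.
Context {R : realType}.
Local Notation mu := (@lebesgue_measure R).

(** Upper rays form a pi-system generating the Borel sets, and those starting at [- n%:R] exhaust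
    the line. *)
Lemma eq_probability_rays (P1 P2 : probability R R) :
  (forall a, P1 `]a, +oo[%classic = P2 `]a, +oo[%classic) ->
  forall B, measurable B -> P1 B = P2 B.
Proof.
move=> P12 B mB.
apply: (@measure_unique _ _ R [set C | exists a : R, C = `]a, +oo[%classic]
  (fun n => `](- n%:R), +oo[%classic) _ _ _ _ P1 P2) => //.
- exact: RGenOInfty.measurableE.
- move=> _ _ [a ->] [b ->]; exists (Num.max a b).
  by apply/seteqP; split=> x /=; rewrite !in_itv/= !andbT gt_max => /andP.
- by move=> n; exists (- n%:R).
- rewrite -subTset => x _; exists (Num.truncn `|x|).+1 => //=.
  rewrite in_itv/= andbT ltrNl (le_lt_trans (ler_norm _))// normrN.
  exact: truncnS_gt.
- by move=> _ [a ->]; exact: P12.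
- by move=> n; rewrite (le_lt_trans (probability_le1 _ _)) ?ltry.
Qed.

Lemma eq_law_rays d1 d2 (T1 : measurableType d1) (T2 : measurableType d2)
    (P1 : probability T1 R) (P2 : probability T2 R) (f1 : T1 -> R) (f2 : T2 -> R) :
  measurable_fun setT f1 -> measurable_fun setT f2 ->
  (forall a, P1 (f1 @^-1` `]a, +oo[%classic) = P2 (f2 @^-1` `]a, +oo[%classic)) ->
  forall B, measurable B -> P1 (f1 @^-1` B) = P2 (f2 @^-1` B).
Proof.
move=> mf1 mf2 P12.
pose g1 : {mfun T1 >-> R} := mfun_Sub (mem_set mf1).
pose g2 : {mfun T2 >-> R} := mfun_Sub (mem_set mf2).
exact: (@eq_probability_rays (distribution P1 g1) (distribution P2 g2) P12).
Qed.

(** [normal_pdf] and the Radon-Nikodym derivative have the same integral over every measurable set,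
    so they agree almost everywhere and can be exchanged under the integral. *)
Lemma integral_normal_prob m s (f : R -> \bar R) :
  (normal_prob m s).-integrable setT f ->
  (\int[normal_prob m s]_x f x = \int[mu]_x (f x * (normal_pdf m s x)%:E))%E.
Proof.
move=> fi; rewrite -(Radon_Nikodym_change_of_variables (normal_prob_dominates m s))//=.
have mf := measurable_int _ fi.
apply: ae_eq_integral => //.
- apply: emeasurable_funM => //; apply: (measurable_int mu).
  by apply: Radon_Nikodym_integrable; exact: normal_prob_dominates.
- by apply: emeasurable_funM => //=; apply/measurable_EFinP; exact: measurable_normal_pdf.
- apply: ae_eqe_mul2l => /=.
  apply: integral_ae_eq => //=.
  + by apply: Radon_Nikodym_integrable; exact: normal_prob_dominates.
  + by apply/measurableT_comp =>//; exact: measurable_normal_pdf.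
  + move=> E _ mE; rewrite -Radon_Nikodym_integral//=; exact: normal_prob_dominates.
Qed.

(** Upper rays suffice, and on a ray the claim is an increasing affine substitution in the
    density. *)
Lemma normal_prob_scale (m s : R) (B : set R) : 0 < s -> measurable B ->
  normal_prob m s B = normal_prob 0 1 ((fun x => s * x + m) @^-1` B).
Proof.
move=> s0 mB.
have mf : measurable_fun setT (fun x : R => s * x + m).
  by apply: measurable_funD => //; exact: measurable_funM.
have der (x : R) : is_derive x 1 (fun x => s * x + m) s.
  apply: is_derive_eq (is_deriveD (is_deriveZ s (is_derive_id x 1)) (is_derive_cst m x 1)) _.
  by rewrite addr0 -[RHS]mulr1.
have der1 : (fun x : R => s * x + m)^`()%classic = cst s.
  by apply/funext => x; rewrite derive1E; apply: derive_val.
suff rays a : normal_prob m s `]a, +oo[%classic =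
    normal_prob 0 1 ((fun x => s * x + m) @^-1` `]a, +oo[%classic).
  exact: (@eq_law_rays _ _ _ _ (normal_prob m s) (normal_prob 0 1) id _ (@measurable_id _ _ setT) mf rays).
have -> : (fun x => s * x + m) @^-1` `]a, +oo[ = `](a - m) / s, +oo[%classic.
  apply/seteqP; split => x; rewrite /= !in_itv/= !andbT ltr_pdivrMr// mulrC ltrBlDr //.
rewrite /normal_prob integral_itv_obnd_cbnd; last first.
  by apply/measurable_funTS/measurable_EFinP; exact: measurable_normal_pdf.
rewrite [in RHS]integral_itv_obnd_cbnd; last first.
  by apply/measurable_funTS/measurable_EFinP; exact: measurable_normal_pdf.
have Fa : (fun x => s * x + m) ((a - m) / s) = a by rewrite mulrC divfK ?gt_eqF// subrK.
rewrite -[in LHS]Fa (@increasing_ge0_integration_by_substitutiony R (fun x : R => s * x + m)) //.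
- apply: eq_integral => x _; rewrite der1 !fctE/= !normal_pdfE ?gt_eqF//.
  congr (_%:E).
  rewrite /normal_peak /normal_fun mulrAC addrK subr0.
  rewrite -!mulrnAr expr1n mul1r sqrtrM ?sqr_ge0// sqrtr_sqr gtr0_norm// invfM.
  congr (_ * expR _); first by rewrite mulrAC mulVf ?gt_eqF// mul1r.
  by field; rewrite gt_eqF.
- by move=> x y _ _ xy; rewrite ltrD2r ltr_pM2l.
- by rewrite der1 => x _; exact: cvg_cst.
- by rewrite der1; exact: is_cvg_cst.
- by rewrite der1; exact: is_cvg_cst.
- split; first by move=> x _; apply: ex_derive.
  by apply: cvg_at_right_filter; apply: cvgD; [apply: cvgM; [exact: cvg_cst|exact: cvg_id]|exact: cvg_cst].
- by apply/cvgryPge => y; near=> x; rewrite -lerBlDr mulrC -ler_pdivrMr.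
- by apply: continuous_subspaceT; apply: continuous_normal_pdf; rewrite gt_eqF.
- by move=> x _; exact: normal_pdf_ge0.
Unshelve. all: by end_near. Qed.

(** This form treats variance zero on the same footing as the others and realises all these laws on
    one space, so that convergence of variances becomes pointwise convergence. *)
Lemma normal_lawE (m v : R) (B : set R) : 0 <= v -> measurable B ->
  normal_law m v B = normal_prob 0 1 ((fun x => Num.sqrt v * x + m) @^-1` B).
Proof.
move=> v0 mB; rewrite /normal_law; case: eqVneq => [->|vn0].
  under eq_fun do rewrite sqrtr0 mul0r add0r.
  rewrite preimage_cst diracE; case: ifPn => // _.
    exact/esym/probability_setT.
  by rewrite measure0.
by rewrite normal_prob_scale// sqrtr_gt0 lt_neqAle eq_sym vn0.
Qed.

(* Completing the square in x. *)
Lemma normal_pdf_mul (a b x z : R) : 0 < a -> 0 < b ->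
  normal_pdf (a * x) b z * normal_pdf 0 1 x =
  normal_pdf 0 (Num.sqrt (a ^+ 2 + b ^+ 2)) z *
  normal_pdf (a * z / (a ^+ 2 + b ^+ 2)) (b / Num.sqrt (a ^+ 2 + b ^+ 2)) x.
Proof.
move=> a0 b0.
have s0 : 0 < a ^+ 2 + b ^+ 2 by rewrite addr_gt0 ?exprn_gt0.
have q0 : 0 < Num.sqrt (a ^+ 2 + b ^+ 2) by rewrite sqrtr_gt0.
rewrite !normal_pdfE ?gt_eqF ?divr_gt0//.
rewrite /normal_peak /normal_fun mulrACA [RHS]mulrACA -!expRD.
congr (_ * expR _); last first.
  rewrite expr_div_n sqr_sqrtr; last exact: ltW.
  by field; rewrite !gt_eqF//.
rewrite -!invfM -!sqrtrM ?mulrn_wge0 ?mulr_ge0 ?sqr_ge0 ?pi_ge0 ?(ltW a0) ?(ltW b0)//.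
congr ((Num.sqrt _)^-1).
rewrite expr_div_n sqr_sqrtr; last exact: ltW.
by field; rewrite gt_eqF.
Qed.

Lemma measurable_normal_pdf2 (a b : R) : 0 < b ->
  measurable_fun setT (fun p : R * R => normal_pdf (a * p.1) b p.2).
Proof.
move=> b0; under eq_fun do rewrite normal_pdfE ?gt_eqF//.
apply: measurable_funM => //.
apply: measurableT_comp => //; apply: measurable_funM => //.
apply: measurableT_comp => //; apply: measurable_funX => //.
apply: measurable_funB => //.
apply: measurable_funM => //.
Qed.

(** For positive [a] and [b], Tonelli exchanges the integrals; by [normal_pdf_mul] the integral over
    the first variable is then the total mass of a normal density, and the density of the sum
    remains. *)
Lemma normal_prob_convolution (a b : R) (B : set R) : 0 <= a -> 0 <= b ->
  measurable B ->
  (normal_prob 0 1 \x normal_prob 0 1)%E ((fun z : R * R => a * z.1 + b * z.2) @^-1` B) =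
  normal_prob 0 1 ((fun x => Num.sqrt (a ^+ 2 + b ^+ 2) * x) @^-1` B).
Proof.
move=> + + mB.
have mfM (c : R) : measurable ((fun x : R => c * x) @^-1` B).
  by rewrite -[X in measurable X]setTI; apply: (measurable_funM (measurable_cst c) (@measurable_id _ _ setT)).
(* When [a] or [b] vanishes one coordinate drops out and the preimage is a rectangle. *)
rewrite le_eqVlt => /predU1P[<- b0|a0].
  rewrite (_ : _ @^-1` B = setT `*` ((fun x => b * x) @^-1` B)); last first.
    by apply/seteqP; split => -[x y] /=; rewrite mul0r add0r// => -[].
  rewrite product_measure1E//; last exact: mfM.
  rewrite -[RHS]mul1e expr0n add0r sqrtr_sqr ger0_norm//; congr (_ * _)%E.
  exact: probability_setT.
rewrite le_eqVlt => /predU1P[<-|b0].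
  rewrite (_ : _ @^-1` B = ((fun x => a * x) @^-1` B) `*` setT); last first.
    by apply/seteqP; split => -[x y] /=; rewrite mul0r addr0// => -[].
  rewrite product_measure1E//; last exact: mfM.
  rewrite -[RHS]mule1 expr0n addr0 sqrtr_sqr gtr0_norm//; congr (_ * _)%E.
  exact: probability_setT.
have s0 : 0 < a ^+ 2 + b ^+ 2 by rewrite addr_gt0 ?exprn_gt0.
have q0 : 0 < Num.sqrt (a ^+ 2 + b ^+ 2) by rewrite sqrtr_gt0.
transitivity (normal_prob 0 (Num.sqrt (a ^+ 2 + b ^+ 2)) B); last first.
  rewrite normal_prob_scale//; congr (normal_prob _ _ _).
  by apply/seteqP; split => x /=; rewrite addr0.
rewrite /product_measure1 /=.
have step x : normal_prob 0 1 (xsection ((fun z : R * R => a * z.1 + b * z.2) @^-1` B) x)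
    = normal_prob (a * x) b B.
  rewrite [RHS]normal_prob_scale//; congr (normal_prob _ _ _).
  by apply/seteqP; split => y; rewrite /xsection /= inE/= addrC.
transitivity (\int[normal_prob 0 1]_x normal_prob (a * x) b B)%E.
  by apply: eq_integral => x _; exact: step.
(* The joint density of the first variable and the sum, cut off outside [B]. *)
pose g (p : R * R) : \bar R := ((normal_pdf (a * p.1) b p.2) * (\1_B p.2) * normal_pdf 0 1 p.1)%:E.
have mg0 : measurable_fun setT (fun p : R * R => normal_pdf (a * p.1) b p.2 * (\1_B p.2)).
  apply: measurable_funM; first exact: measurable_normal_pdf2.
  by apply: measurableT_comp => //; exact: measurable_indic.
have mg : measurable_fun setT g.
  apply/measurable_EFinP/measurable_funM => //.
  apply: measurableT_comp => //; exact: measurable_normal_pdf.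
have g0 p : (0 <= g p)%E by rewrite lee_fin !mulr_ge0 ?normal_pdf_ge0.
have NE m s : normal_prob m s B = (\int[mu]_z (normal_pdf m s z * \1_B z)%:E)%E.
  rewrite /normal_prob integral_mkcond; apply: eq_integral => z _.
  rewrite patchE indicE; case: ifPn => _; by rewrite ?mulr1 ?mulr0.
transitivity (\int[mu]_x \int[mu]_z g (x, z))%E.
  rewrite integral_normal_prob; last first.
    apply/integrableP; split.
      under eq_fun do rewrite -step.
      apply: measurable_fun_xsection => //.
      rewrite -[X in measurable X]setTI.
      by apply: measurable_funD => //; apply: measurable_funM.
    apply: (@le_lt_trans _ _ (\int[normal_prob 0 1]_x cst 1 x)%E).
      apply: ge0_le_integral => //=.
      - apply: measurableT_comp => //. under eq_fun do rewrite -step.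
        apply: measurable_fun_xsection => //.
        rewrite -[X in measurable X]setTI.
        by apply: measurable_funD => //; apply: measurable_funM.
      - by move=> x _; rewrite gee0_abs// probability_le1.
    by rewrite integral_cst//= mul1e (le_lt_trans (probability_le1 _ _)) ?ltry.
  apply: eq_integral => x _; rewrite NE -ge0_integralZr//.
  - apply/measurable_EFinP/measurable_funM; last exact: measurable_indic.
    exact: measurable_normal_pdf.
  - by move=> z _; rewrite lee_fin mulr_ge0 ?normal_pdf_ge0.
  - by rewrite lee_fin normal_pdf_ge0.
rewrite fubini_tonelli// NE; apply: eq_integral => z _.
under eq_integral do rewrite /g /= mulrAC normal_pdf_mul// mulrAC EFinM.
rewrite ge0_integralZl//.
- by rewrite integral_normal_pdf mule1.
- by apply/measurable_EFinP; exact: measurable_normal_pdf.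
- by move=> x _; rewrite lee_fin normal_pdf_ge0.
- by rewrite lee_fin mulr_ge0 ?normal_pdf_ge0.
Qed.

Lemma bounded_convergence d (T : measurableType d) (P : probability T R)
    (f : (T -> R)^nat) (g : T -> R) :
  (forall n, measurable_fun setT (f n)) -> measurable_fun setT g ->
  (forall n x, 0 <= f n x <= 1) ->
  {ae P, forall x, f ^~ x @ \oo --> g x} ->
  (\int[P]_x (f n x)%:E)%E @[n --> \oo] --> (\int[P]_x (g x)%:E)%E.
Proof.
move=> mf mg f01 fg.
have [|||||_ _] := @dominated_convergence _ _ _ P setT measurableT
  (fun n x => (f n x)%:E) (fun x => (g x)%:E) (cst 1%E) => //.
- by move=> n; exact/measurable_EFinP.
- exact/measurable_EFinP.
- by apply: filterS fg => x fx _; apply: cvg_EFin => //; apply: nearW.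
- apply/integrableP; split => //=.
  under eq_integral do rewrite normr1.
  by rewrite integral_cst// mul1e (le_lt_trans (probability_le1 _ _)) ?ltry.
- apply: nearW => x n _ /=; rewrite lee_fin ger0_norm; by case/andP: (f01 n x).
Qed.

(** Dominated convergence on each space preserves equality of expectations for continuous functions
    with values in [0, 1], and these determine a law. The spaces may differ because the Brownian
    sums are compared with multiples of one standard normal variable. *)
Lemma law_limit d1 d2 (T1 : measurableType d1) (T2 : measurableType d2)
    (P1 : probability T1 R) (P2 : probability T2 R)
    (f1 : (T1 -> R)^nat) (f2 : (T2 -> R)^nat) (g1 : T1 -> R) (g2 : T2 -> R) :
  (forall n, measurable_fun setT (f1 n)) -> (forall n, measurable_fun setT (f2 n)) ->
  measurable_fun setT g1 -> measurable_fun setT g2 ->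
  {ae P1, forall x, f1 ^~ x @ \oo --> g1 x} ->
  {ae P2, forall x, f2 ^~ x @ \oo --> g2 x} ->
  (forall n B, measurable B -> P1 (f1 n @^-1` B) = P2 (f2 n @^-1` B)) ->
  forall B, measurable B -> P1 (g1 @^-1` B) = P2 (g2 @^-1` B).
Proof.
move=> mf1 mf2 mg1 mg2 fg1 fg2 f12.
have f12_int (h : R -> R) : continuous h -> (forall x, 0 <= h x <= 1) ->
    (\int[P1]_x (h (g1 x))%:E)%E = (\int[P2]_x (h (g2 x))%:E)%E.
  move=> hc h01.
  have mh : measurable_fun setT h by exact: continuous_measurable_fun.
  have H1 : (\int[P1]_x (h (f1 n x))%:E)%E @[n --> \oo] --> (\int[P1]_x (h (g1 x))%:E)%E.
    apply: bounded_convergence => //.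
    - by move=> n; exact: measurableT_comp.
    - exact: measurableT_comp.
    - by apply: filterS fg1 => x fx; apply: (continuous_cvg _ _ fx); exact: hc.
  have H2 : (\int[P2]_x (h (f2 n x))%:E)%E @[n --> \oo] --> (\int[P2]_x (h (g2 x))%:E)%E.
    apply: bounded_convergence => //.
    - by move=> n; exact: measurableT_comp.
    - exact: measurableT_comp.
    - by apply: filterS fg2 => x fx; apply: (continuous_cvg _ _ fx); exact: hc.
  suff En n : (\int[P1]_x (h (f1 n x))%:E)%E = (\int[P2]_x (h (f2 n x))%:E)%E.
    by move: H1; rewrite (funext En) => H1; exact: (cvg_unique _ H1 H2).
  pose F1 : {mfun T1 >-> R} := mfun_Sub (mem_set (mf1 n)).
  pose F2 : {mfun T2 >-> R} := mfun_Sub (mem_set (mf2 n)).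
  have mEh : measurable_fun setT (fun x => (h x)%:E) by exact/measurable_EFinP.
  have h0 x : (0 <= (h x)%:E)%E by rewrite lee_fin; case/andP: (h01 x).
  transitivity (\int[distribution P1 F1]_y (h y)%:E)%E; first by rewrite ge0_integral_distribution.
  transitivity (\int[distribution P2 F2]_y (h y)%:E)%E; last by rewrite ge0_integral_distribution.
  by apply: eq_measure_integral => B mB _; exact: f12.
apply: eq_law_rays => // a.
(* Continuous ramps that increase to the indicator of ]a, +oo[ *)
pose h (n : nat) (x : R) := Num.min 1 (n%:R * Num.max 0 (x - a)).
have hc n : continuous (h n).
  move=> x; apply: (@continuous_min _ _ (cst 1) (fun x => n%:R * Num.max 0 (x - a))); first exact: cvg_cst.
  apply: (@continuousM _ _ (cst n%:R) (fun x => Num.max 0 (x - a))); first exact: cvg_cst.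
  apply: (@continuous_max _ _ (cst 0) (fun x => x - a)); first exact: cvg_cst.
  by apply: (@continuousB _ _ _ id (cst a)); [exact: cvg_id|exact: cvg_cst].
have h01 n x : 0 <= h n x <= 1.
  by rewrite /h le_min ler01/= ge_min lexx/= andbT mulr_ge0// le_max lexx.
have hl x : h ^~ x @ \oo --> (\1_(`]a, +oo[%classic) x : R).
  rewrite indicE; have [|] := boolP (x \in `]a, +oo[%classic).
    rewrite inE/= in_itv/= andbT => ax.
    apply: cvg_near_cst; near=> n.
    rewrite /h max_r ?subr_ge0 ?(ltW ax)//; apply/min_idPl.
    rewrite -ler_pdivrMr ?subr_gt0// mul1r.
    near: n; exact: nbhs_infty_ger.
  rewrite notin_setE/= in_itv/= andbT => /negP; rewrite -leNgt => xa.
  apply: cvg_near_cst; near=> n.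
  by rewrite /h max_l ?subr_le0// mulr0 min_r.
have H d (T : measurableType d) (P : probability T R) (g : T -> R) : measurable_fun setT g ->
    (\int[P]_x (h n (g x))%:E)%E @[n --> \oo] --> P (g @^-1` `]a, +oo[%classic).
  move=> mg; rewrite (_ : P _ = (\int[P]_x (\1_(`]a, +oo[%classic) (g x) : R)%:E)%E); last first.
    rewrite (_ : (fun x => _) = (fun x => (\1_(g @^-1` `]a, +oo[%classic) x)%:E)) //.
    rewrite integral_indic ?setIT//.
    by rewrite -[X in measurable X]setTI; exact: mg.
  apply: bounded_convergence => //.
  - by move=> n; apply: measurableT_comp => //; exact: continuous_measurable_fun.
  - by apply: measurableT_comp => //; exact: measurable_indic.
  - exact: nearW.
have := H _ _ P1 g1 mg1; rewrite (funext (fun n => f12_int _ (hc n) (h01 n))) => H1.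
exact: cvg_unique H1 (H _ _ P2 g2 mg2).
Unshelve. all: by end_near. Qed.

(** Bundles the pushforward with its measure structure, the form in which uniqueness of product
    measures applies to it. *)
Definition pushforward_measure d1 d2 (T1 : measurableType d1) (T2 : measurableType d2)
    (m : {measure set T1 -> \bar R}) (f : T1 -> T2) (mf : measurable_fun setT f) :
    {measure set T2 -> \bar R} :=
  measure_function_pushforward__canonical__measure_function_Measure m mf.

(** Given [A], the pair [(X, Y)] has a product law by uniqueness of product measures, the same as
    that of two scaled independent standard normals, whose sum is known. The event [A] stands for
    the variables that the induction in [indep_sum_normal] has not yet summed. *)
Lemma two_normal_law d (T : measurableType d) (P : probability T R) (A : set T)
    (X Y : T -> R) (u v c : R) :
  measurable A -> measurable_fun setT X -> measurable_fun setT Y ->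
  0 <= u -> 0 <= v -> 0 <= c ->
  (forall B1 B2, measurable B1 -> measurable B2 ->
    P (X @^-1` B1 `&` Y @^-1` B2 `&` A) = (normal_law 0 u B1 * normal_law 0 v B2 * c%:E)%E) ->
  forall B, measurable B ->
    P ((fun w => X w + Y w) @^-1` B `&` A) = (normal_law 0 (u + v) B * c%:E)%E.
Proof.
move=> mA mX mY u0 v0 c0 XY B mB.
have PA : P A = c%:E.
  have := XY setT setT measurableT measurableT.
  rewrite !preimage_setT !setTI !normal_lawE// !preimage_setT => ->.
  rewrite -[RHS]mul1e; congr (_ * _)%E.
  rewrite -[RHS]mul1e; congr (_ * _)%E; exact: probability_setT.
(* If [A] is null, one cannot condition on it, but both sides vanish. *)
move: c0; rewrite le_eqVlt => /predU1P[c0|c0].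
  rewrite -c0 mule0; apply/eqP; rewrite eq_le measure_ge0 andbT.
  rewrite [leRHS](_ : _ = P A); last by rewrite PA -c0.
  apply: le_measure; rewrite ?inE//; apply: measurableI => //.
  by rewrite -[X in measurable X]setTI; apply: measurable_funD.
have mXY : measurable_fun setT (fun w => (X w, Y w)) by exact: measurable_fun_pair.
have cV : 0 <= c^-1 by rewrite invr_ge0 ltW.
(* The law of [(X, Y)] conditional on [A]. *)
pose mu1 := mscale (NngNum cV) (pushforward_measure (mrestr P mA) mXY).
have msq (a : R) : measurable_fun setT (fun x : measurableTypeR R => a * x : R) by exact: measurable_funM.
pose fsq (a : R) : {mfun measurableTypeR R >-> R} := mfun_Sub (mem_set (msq a)).
pose L (a : R) := distribution (normal_prob 0 1) (fsq a).
have LE (w : R) : 0 <= w -> forall C, measurable C -> L (Num.sqrt w) C = normal_law 0 w C.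
  move=> w0 C mC; rewrite normal_lawE//; congr (normal_prob _ _ _).
  by apply/seteqP; split => x /=; rewrite addr0.
have E1 := @product_measure_unique _ _ _ _ _ (L (Num.sqrt u)) (L (Num.sqrt v)) mu1.
have mphi : measurable_fun setT (fun z : measurableTypeR R * measurableTypeR R =>
    (Num.sqrt u * z.1, Num.sqrt v * z.2) : (R * R)%type).
  by apply: measurable_fun_pair; apply: measurable_funM.
pose mu2 := pushforward_measure (normal_prob 0 1 \x normal_prob 0 1)%E mphi.
have E2 := @product_measure_unique _ _ _ _ _ (L (Num.sqrt u)) (L (Num.sqrt v)) mu2.
have mC : measurable ((fun z : R * R => z.1 + z.2) @^-1` B).
  by rewrite -[X in measurable X]setTI; apply: measurable_funD.
have : (c^-1%:E * P ((fun w => (X w + Y w)%R) @^-1` B `&` A))%E = normal_law 0 (u + v) B.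
  transitivity (mu1 ((fun z : R * R => z.1 + z.2) @^-1` B)) => //.
  transitivity ((L (Num.sqrt u) \x L (Num.sqrt v))%E ((fun z : R * R => z.1 + z.2) @^-1` B)).
    apply/esym/E1 => //.
    move=> A1 A2 mA1 mA2.
    transitivity (normal_law 0 u A1 * normal_law 0 v A2)%E; last first.
      by congr (_ * _)%E; exact/esym/LE.
    transitivity (c^-1%:E * P (X @^-1` A1 `&` Y @^-1` A2 `&` A))%E => //.
    by rewrite XY// muleC -muleA -EFinM divff ?gt_eqF// mule1.
  transitivity (mu2 ((fun z : R * R => z.1 + z.2) @^-1` B)).
    apply: E2 => //.
    move=> A1 A2 mA1 mA2.
    rewrite /mu2 /= /pushforward.
    rewrite (_ : _ @^-1` _ = ((fun x => Num.sqrt u * x) @^-1` A1) `*` ((fun x => Num.sqrt v * x) @^-1` A2)) //.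
    rewrite product_measure1E //.
      by rewrite -[X in measurable X]setTI; apply: (msq (Num.sqrt u)).
    by rewrite -[X in measurable X]setTI; apply: (msq (Num.sqrt v)).
  rewrite normal_lawE ?addr_ge0//.
  rewrite [LHS](normal_prob_convolution _ _ mB)//.
  congr (normal_prob _ _ _).
  by apply/seteqP; split => x /=; rewrite addr0 !sqr_sqrtr.
move=> <-; rewrite muleC muleA -EFinM divff ?gt_eqF// mul1e//.
Qed.

Lemma indep_sum_normal d (T : measurableType d) (P : probability T R)
    (I : finType) (Y : I -> T -> R) (v : I -> R) :
  (forall i, measurable_fun setT (Y i)) -> (forall i, 0 <= v i) ->
  (forall i B, measurable B -> P (Y i @^-1` B) = normal_law 0 (v i) B) ->
  (forall (J : {set I}) (B : I -> set R), (forall i, measurable (B i)) ->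
    P (\bigcap_(i in [set` J]) Y i @^-1` B i) =
    (\prod_(i in J) P (Y i @^-1` B i))%E) ->
  forall B, measurable B ->
    P ((fun w => \sum_i Y i w) @^-1` B) = normal_law 0 (\sum_i v i) B.
Proof.
move=> mY v0 lY iY.
(* The induction carries along the events of the variables not yet summed,
   which encodes their joint independence from the partial sum. *)
suff H (s : seq I) (J : {set I}) (B : I -> set R) B0 : uniq s ->
    (forall i, i \in s -> i \notin J) -> (forall i, measurable (B i)) -> measurable B0 ->
    P ((fun w => \sum_(i <- s) Y i w) @^-1` B0 `&` \bigcap_(i in [set` J]) Y i @^-1` B i) =
    (normal_law 0 (\sum_(i <- s) v i) B0 * \prod_(i in J) P (Y i @^-1` B i))%E.
  move=> B mB; have := H (index_enum I) finset.set0 (fun=> setT) B (index_enum_uniq I).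
  rewrite big_set0 mule1 => <- //; last by move=> i _; rewrite inE.
  congr (P _); apply/seteqP; split => [x Bx|x []//].
  by split => // i; rewrite /= inE.
have mcap (J' : {set I}) (B' : I -> set R) : (forall i, measurable (B' i)) ->
    measurable (\bigcap_(i in [set` J']) Y i @^-1` B' i).
  move=> mB'; apply: fin_bigcap_measurable => // i _.
  by rewrite -[X in measurable X]setTI; exact: mY.
elim: s J B B0 => [|i s IH] J B B0 /=.
  move=> _ _ mB mB0; under eq_fun do rewrite big_nil; rewrite big_nil.
  (* The empty sum is constantly 0, with the Dirac mass that [normal_law] assigns to variance 0. *)
  rewrite /normal_law eqxx diracE preimage_cst; case: ifPn => _.
    by rewrite setTI mul1e iY.
  by rewrite set0I measure0 mul0e.
move=> /andP[si us] sJ mB mB0.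
have fP j : P (Y j @^-1` B j) \is a fin_num.
  by apply: fin_num_measure; rewrite -[X in measurable X]setTI; exact: mY.
have [c cE] : exists c : R, (\prod_(j in J) P (Y j @^-1` B j) = c%:E)%E.
  exists (fine (\prod_(j in J) P (Y j @^-1` B j))%E); rewrite fineK//.
  by apply: prode_fin_num => j _; exact: fP.
have c0 : 0 <= c.
  by rewrite -lee_fin -cE; apply: prode_ge0 => j _; exact: measure_ge0.
rewrite big_cons cE; under eq_fun do rewrite big_cons.
apply: two_normal_law => //.
- exact: mcap.
- exact: measurable_sum.
- exact: sumr_ge0.
move=> B1 B2 mB1 mB2.
have iJ : i \notin J by apply: sJ; rewrite inE eqxx.
(* The variable [i] joins [J] with event [B1], so the induction hypothesis yields the triple product
   that [two_normal_law] asks for. *)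
pose B' j := if j == i then B1 else B j.
have mB' j : measurable (B' j) by rewrite /B'; case: ifP.
have := IH (i |: J) B' B2 us _ mB' mB2.
have B'i : B' i = B1 by rewrite /B' eqxx.
rewrite big_setU1//= lY// B'i (_ : (\prod_(j in J) _ = c%:E)%E); last first.
  rewrite -cE; apply: eq_bigr => j jJ; rewrite /B'; case: eqVneq => // ji.
  by rewrite -ji jJ in iJ.
have sJ' j : j \in s -> j \notin i |: J.
  move=> js; rewrite !inE negb_or sJ ?inE ?js ?orbT// andbT.
  by apply: contraNneq si => <-.
move=> /(_ sJ') E.
have AC (x y z : \bar R) : (x * y * z = y * (x * z))%E by rewrite (muleC x) muleA.
rewrite AC -[RHS]E.
congr (P _); apply/seteqP; split => w /=.
  move=> [[Y1 Y2] YJ]; split => // j /=; rewrite !inE /B'.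
  case: eqVneq => [->//|ji /=]; exact: YJ.
move=> [Y2 YJ]; split; first split => //.
  by have := YJ i; rewrite /= /B' eqxx; apply; rewrite !inE eqxx.
move=> j /= jJ; have := YJ j; rewrite /= /B' !inE jJ orbT; case: eqVneq => [ji|_]; last exact.
by rewrite -ji jJ in iJ.
Qed.

End NormalLaws.

(** * Linear combinations of Brownian increments *)

Lemma big_option (R : Type) (idx : R) (op : Monoid.com_law idx) (I : finType)
    (f : option I -> R) :
  \big[op/idx]_o f o = op (f None) (\big[op/idx]_i f (Some i)).
Proof.
rewrite (bigD1 None)//=; congr (op _ _).
by rewrite (reindex_omap Some id) => [|[]//]; apply: eq_bigl => i; rewrite /= eqxx.
Qed.

Section BrownianSums.
Context {R : realType} {disp : measure_display} {Om : measurableType disp}.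
Variable Pr : probability Om R.

(** Independence is stated for families of events on [Om], so measurability is expressed relative to
    such a family; [sub_measurableP] passes to the measurable type that it generates. *)
Definition sub_measurable (F : set (set Om)) (Y : Om -> R) :=
  forall B, measurable B -> F (Y @^-1` B).

Lemma sub_measurableP (F : set (set Om)) (Y : Om -> R) : sigma_algebra setT F ->
  sub_measurable F Y <-> measurable_fun (setT : set (g_sigma_algebraType F)) Y.
Proof.
move=> sF; have FE : <<s F >> = F by exact: sigma_algebra_id.
have mE (A : set (g_sigma_algebraType F)) : measurable A = <<s F >> A by [].
split => [FY _ B mB|mY B mB].
  by rewrite setTI mE FE; exact: FY.
by have := mY measurableT B mB; rewrite setTI mE FE.
Qed.

Lemma sub_measurable_sum (F : set (set Om)) (I : Type) (s : seq I) (Y : I -> Om -> R) :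
  sigma_algebra setT F -> (forall i, sub_measurable F (Y i)) ->
  sub_measurable F (fun w => \sum_(i <- s) Y i w).
Proof.
move=> sF FY; apply/sub_measurableP => //; apply: measurable_sum => i.
by apply/sub_measurableP.
Qed.

Lemma sub_measurableZ (F : set (set Om)) (a : R) (Y : Om -> R) :
  sigma_algebra setT F -> sub_measurable F Y -> sub_measurable F (fun w => a * Y w).
Proof.
move=> sF /sub_measurableP -/(_ sF) mY; apply/sub_measurableP => //.
exact: measurable_funM.
Qed.

Lemma sub_measurableB (F : set (set Om)) (Y Z : Om -> R) :
  sigma_algebra setT F -> sub_measurable F Y -> sub_measurable F Z ->
  sub_measurable F (fun w => Y w - Z w).
Proof.
move=> sF /sub_measurableP -/(_ sF) mY /sub_measurableP -/(_ sF) mZ.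
apply/sub_measurableP => //; exact: measurable_funB.
Qed.

Lemma sub_measurable_linear (F : set (set Om)) n (u : 'cV[R]_n) (X : Om -> 'cV[R]_n) :
  sigma_algebra setT F -> (forall i, sub_measurable F (fun w => X w i 0)) ->
  sub_measurable F (fun w => (u^T *m X w) 0 0).
Proof.
move=> sF FX; under eq_fun do rewrite mxE.
apply: sub_measurable_sum => // i; exact: sub_measurableZ.
Qed.

Lemma sigma_vector_measurable n (X : Om -> 'cV[R]_n) i :
  sub_measurable (sigma_vector X) (fun w => X w i 0).
Proof.
move=> B mB; apply: sub_sigma_algebra.
rewrite (bigD1 i)//=; left; exists B => //; by rewrite setTI.
Qed.

Lemma sigma_process_measurable n (T : R) (W : R -> Om -> 'cV[R]_n) t i :
  0 <= t <= T -> sub_measurable (sigma_process T W) (fun w => W t w i 0).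
Proof.
move=> tT B mB; apply: sub_sigma_algebra; exists t; first by rewrite /= in_itv.
exact: sigma_vector_measurable.
Qed.

Lemma random_vector_linear n (u : 'cV[R]_n) (X : Om -> 'cV[R]_n) :
  random_vector X -> measurable_fun setT (fun w => (u^T *m X w) 0 0).
Proof.
move=> mX; under eq_fun do rewrite mxE.
apply: measurable_sum => i; exact: measurable_funM.
Qed.

Section Partition.
Variables (T : R) (N : nat) (r : nat -> R).
Hypotheses (r0 : 0 <= r 0%N) (rT : r N <= T).
Hypothesis rS : forall i, (i < N)%N -> r i < r i.+1.

Lemma partition_le i j : (i <= j <= N)%N -> r i <= r j.
Proof.
elim: j => [|j IH]; first by rewrite leqn0 => /andP[/eqP->].
rewrite leq_eqVlt => /andP[/predU1P[->//|ij] jN].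
by rewrite (le_trans (IH _)) ?(ltW (rS _))// -ltnS ij ltnW.
Qed.

Lemma partition_itv i : (i <= N)%N -> 0 <= r i <= T.
Proof.
move=> iN; rewrite (le_trans r0) ?(partition_le)//=.
by rewrite (le_trans _ rT) ?partition_le// iN leqnn.
Qed.

(** Independence of increments within one Brownian motion gives the law. Locating the sum in the
    sigma-algebra of that motion prepares the use of independence between agents. The partition is
    strict since Gaussian increments are specified for [s < t]. *)
Lemma brownian_sum_law n (W : R -> Om -> 'cV[R]_n) (al : nat -> 'cV[R]_n) :
  brownian_motion Pr T W ->
  let S := fun w => \sum_(i < N) ((al i)^T *m (W (r i.+1) w - W (r i) w)) 0 0 in
  [/\ sub_measurable (sigma_process T W) S, measurable_fun setT S &
  forall B, measurable B -> Pr (S @^-1` B) =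
    normal_law 0 (\sum_(i < N) (r i.+1 - r i) * ((al i)^T *m al i) 0 0) B].
Proof.
move=> [rvW _ gW iW] S.
have itv1 (i : 'I_N) : 0 <= r i <= T by apply: partition_itv; exact: ltnW.
have itv2 (i : 'I_N) : 0 <= r i.+1 <= T by apply: partition_itv.
have rvI (i : 'I_N) : random_vector (fun w => W (r i.+1) w - W (r i) w).
  move=> j; rewrite (_ : (fun w => _) = (fun w => W (r i.+1) w j 0 - W (r i) w j 0)); last first.
    by apply/funext => w; rewrite !mxE.
  by apply: measurable_funB; apply: rvW; rewrite in_itv/=.
have sP : sigma_algebra setT (sigma_process T W) by exact: smallest_sigma_algebra.
split.
- apply: sub_measurable_sum => // i; apply: sub_measurable_linear => // j.
  rewrite (_ : (fun w => _) = (fun w => W (r i.+1) w j 0 - W (r i) w j 0)); last first.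
    by apply/funext => w; rewrite !mxE.
  by apply: sub_measurableB => //; apply: sigma_process_measurable.
- by apply: measurable_sum => i; exact: random_vector_linear.
pose Y (i : 'I_N) w := ((al i)^T *m (W (r i.+1) w - W (r i) w)) 0 0.
apply: (@indep_sum_normal _ _ _ Pr _ Y).
- by move=> i; exact: random_vector_linear.
- move=> i; rewrite mulr_ge0 ?subr_ge0 ?(ltW (rS _))// mxE sumr_ge0// => j _.
  by rewrite mxE -expr2 sqr_ge0.
- move=> i B mB; have /andP[ri0 _] := itv1 i; have /andP[_ riT] := itv2 i.
  have [_ /(_ (al i) B mB)] := gW _ _ ri0 (rS (ltn_ord i)) riT.
  rewrite mulmx0 mxE /qform mul_mx_scalar -scalemxAl mxE => <-//.
- move=> J B mB.
  have rle i : (i < N)%N -> r i <= r i.+1 by move=> iN; exact: ltW (rS iN).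
  apply: (iW N r r0 rle rT J (fun i => Y i @^-1` B i)) => i.
  apply: sub_measurable_linear => // [|j]; first exact: smallest_sigma_algebra.
  exact: sigma_vector_measurable.
Qed.

(** The second use of independence: the row [al i] splits into one block per agent, [None] being the
    major agent, and the resulting sums lie in independent sigma-algebras. *)
Lemma brownian_family_sum_law d0 d q (W0 : R -> Om -> 'cV[R]_d0)
    (Wobs : 'I_q -> R -> Om -> 'cV[R]_d)
    (al : nat -> 'rV[R]_(d0 + \sum_(i < q) d)) :
  brownian_motion Pr T W0 ->
  (forall i, brownian_motion Pr T (Wobs i)) ->
  mutually_independent Pr
    (fun i : option 'I_q =>
       if i is Some j then sigma_process T (Wobs j) else sigma_process T W0) ->
  let W := fun s w => col_mx (W0 s w) (\mxcol_(i < q) Wobs i s w) in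
  let S := fun w => \sum_(i < N) (al i *m (W (r i.+1) w - W (r i) w)) 0 0 in
  measurable_fun setT S /\
  forall B, measurable B -> Pr (S @^-1` B) =
    normal_law 0 (\sum_(i < N) (r i.+1 - r i) * (al i *m (al i)^T) 0 0) B.
Proof.
move=> bW0 bWobs iW W S.
pose al0 i : 'cV[R]_d0 := (lsubmx (al i))^T.
pose al1 (j : 'I_q) i : 'cV[R]_d := (submxrow (rsubmx (al i)) j)^T.
have alE i : al i = row_mx (al0 i)^T (\mxrow_j (al1 j i)^T).
  rewrite /al0 /al1 trmxK -[LHS]hsubmxK; congr row_mx.
  by rewrite -[LHS]submxrowK; apply: eq_mxrow => j; rewrite trmxK.
pose Y (o : option 'I_q) w := if o is Some j
  then \sum_(i < N) ((al1 j i)^T *m (Wobs j (r i.+1) w - Wobs j (r i) w)) 0 0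
  else \sum_(i < N) ((al0 i)^T *m (W0 (r i.+1) w - W0 (r i) w)) 0 0.
pose v (o : option 'I_q) := if o is Some j
  then \sum_(i < N) (r i.+1 - r i) * ((al1 j i)^T *m al1 j i) 0 0
  else \sum_(i < N) (r i.+1 - r i) * ((al0 i)^T *m al0 i) 0 0.
have SE : S = fun w => \sum_o Y o w.
  apply/funext => w; rewrite big_option /S /Y exchange_big -big_split /=.
  apply: eq_bigr => i _; rewrite alE /W opp_col_mx add_col_mx mul_row_col.
  have -> : \mxcol_j Wobs j (r i.+1) w - \mxcol_j Wobs j (r i) w =
      \mxcol_j (Wobs j (r i.+1) w - Wobs j (r i) w).
    by rewrite -mxcolN -mxcolD.
  by rewrite mul_mxrow_mxcol mxE summxE.
have vE : \sum_(i < N) (r i.+1 - r i) * (al i *m (al i)^T) 0 0 = \sum_o v o.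
  rewrite big_option /v exchange_big -big_split /=.
  apply: eq_bigr => i _; rewrite alE tr_row_mx tr_mxrow mul_row_col mul_mxrow_mxcol.
  rewrite mxE summxE -mulr_sumr -mulrDr trmxK; congr (_ * (_ + _)).
  by apply: eq_bigr => j _; rewrite trmxK.
have bY o : [/\ sub_measurable (if o is Some j then sigma_process T (Wobs j) else sigma_process T W0) (Y o),
    measurable_fun setT (Y o) & forall B, measurable B -> Pr (Y o @^-1` B) = normal_law 0 (v o) B].
  by case: o => [j|]; exact: brownian_sum_law.
rewrite vE SE; split; first by apply: measurable_sum => o; case: (bY o).
apply: indep_sum_normal.
- by move=> o; case: (bY o).
- have vn n (u : nat -> 'cV[R]_n) : 0 <= \sum_(i < N) (r i.+1 - r i) * ((u i)^T *m u i) 0 0.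
    apply: sumr_ge0 => i _; rewrite mulr_ge0 ?subr_ge0 ?(ltW (rS _))// mxE sumr_ge0// => j _.
    by rewrite mxE -expr2 sqr_ge0.
  by case => [j|]; exact: vn.
- by move=> o; case: (bY o).
- move=> J B mB; apply: (iW J (fun o => Y o @^-1` B o)) => o.
  by case: (bY o) => + _ _; apply.
Qed.

End Partition.
End BrownianSums.

(** * The profile maximum-likelihood estimator *)

Section QuadraticForms.
Context {R : realType}.

Lemma trmx00 (A : 'M[R]_1) : A^T 0 0 = A 0 0.
Proof. by rewrite mxE. Qed.

Lemma bilinear_tr m n (S : 'M[R]_(m, n)) (x : 'cV[R]_m) (y : 'cV[R]_n) :
  (x^T *m S *m y) 0 0 = (y^T *m S^T *m x) 0 0.
Proof. by rewrite -[LHS]trmx00 !trmx_mul trmxK mulmxA. Qed.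

Lemma qformD n (S : 'M[R]_n) (x y : 'cV[R]_n) : S^T = S ->
  qform S (x + y) = qform S x + 2 * (x^T *m S *m y) 0 0 + qform S y.
Proof.
move=> symS; have tD : (x + y)^T = x^T + y^T by rewrite linearD.
rewrite /qform tD !mulmxDl !mulmxDr mxE [X in X + _]mxE [X in _ + X]mxE.
have -> : (y^T *m S *m x) 0 0 = (x^T *m S *m y) 0 0.
  by rewrite bilinear_tr symS.
by ring.
Qed.

Lemma qform0 n (S : 'M[R]_n) : qform S 0 = 0.
Proof. by rewrite /qform mulmx0 mxE. Qed.

Lemma qformM m n (S : 'M[R]_m) (H : 'M[R]_(m, n)) x : qform S (H *m x) = qform (H^T *m S *m H) x.
Proof. by rewrite /qform trmx_mul !mulmxA. Qed.

Lemma tr_sandwich m n (S : 'M[R]_m) (H : 'M[R]_(m, n)) : S^T = S ->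
  (H^T *m S *m H)^T = H^T *m S *m H.
Proof. by move=> symS; rewrite !trmx_mul trmxK symS mulmxA. Qed.

Lemma qformB n (S S' : 'M[R]_n) x : qform (S - S') x = qform S x - qform S' x.
Proof. by rewrite /qform mulmxBr mulmxBl mxE [X in _ + X]mxE. Qed.

Lemma posdef_ge0 n (S : 'M[R]_n) x : posdef S -> 0 <= qform S x.
Proof.
move=> [_ S0]; have [->|/S0/ltW//] := eqVneq x 0.
by rewrite qform0.
Qed.

Lemma posdef_le0 n (S : 'M[R]_n) x : posdef S -> qform S x <= 0 -> x = 0.
Proof.
move=> [_ S0] Sx; apply/eqP; apply: contraTT Sx => x0.
by rewrite -ltNge S0.
Qed.

Lemma posdef_unit n (S : 'M[R]_n) : posdef S -> S \in unitmx.
Proof.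
move=> pS; rewrite unitmxE unitfE; apply/negP => /det0P[v v0 vS].
have : v^T = 0 by apply: (posdef_le0 pS); rewrite /qform trmxK vS mul0mx mxE.
by move=> /(congr1 trmx); rewrite trmxK trmx0 => /eqP; rewrite (negbTE v0).
Qed.

(* The determinant cannot vanish on the segment from the identity to S. *)
Lemma posdef_det_gt0 n (S : 'M[R]_n) : posdef S -> 0 < \det S.
Proof.
move=> [symS pS]; pose f (u : R) : 'M[R]_n := (1 - u)%:M + u *: S.
have cf : cont_on 0 1 (fun u => \det (f u)).
  apply: cont_on_det; apply: (@mcont_eq _ _ _ _ _ _ (fun i j u => (1 - u) *+ (i == j) + u * S i j)).
    by move=> u i j; rewrite !mxE.
  move=> i j; have cid : cont_on 0 1 (fun u : R => u).
    by apply: continuous_subspaceT => z; exact: cvg_id.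
  apply: cont_onD; last by apply: cont_onM => //; exact: cont_on_cst.
  case: (i == j); rewrite ?mulr1n ?mulr0n; last exact: cont_on_cst.
  by apply: cont_onB => //; exact: cont_on_cst.
have f0 u : 0 <= u <= 1 -> \det (f u) != 0.
  move=> /andP[u0 u1]; rewrite -unitfE -unitmxE; apply: posdef_unit; split.
    by rewrite linearD /= tr_scalar_mx linearZ /= symS.
  move=> x x0; rewrite /qform mulmxDr mulmxDl mul_mx_scalar -scalemxAl -scalemxAr -scalemxAl.
  have xx : 0 < (x^T *m x) 0 0.
    rewrite lt_neqAle eq_sym mxE psumr_neq0; last by move=> i _; rewrite mxE -expr2 sqr_ge0.
    rewrite sumr_ge0 ?andbT; last by move=> i _; rewrite mxE -expr2 sqr_ge0.
    have [i xi] : exists i, x i 0 != 0.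
      apply/existsP; apply: contraNT x0 => /existsPn xi; apply/eqP/colP => i.
      by have := xi i; rewrite negbK mxE => /eqP.
    by apply/hasP; exists i; rewrite ?mem_index_enum //= mxE -expr2 lt_neqAle sqr_ge0 eq_sym sqrf_eq0 xi.
  have := pS x x0; rewrite /qform => Sx; rewrite mxE [X in X + _]mxE [X in _ + X]mxE.
  move: u0; rewrite le_eqVlt => /predU1P[<-|u0].
    by rewrite subr0 mul1r mul0r addr0.
  by rewrite ltr_wpDl ?mulr_gt0 ?mulr_ge0 ?subr_ge0 ?(ltW xx).
have f0E : f 0 = 1%:M by rewrite /f subr0 scale0r addr0.
have f1E : f 1 = S by rewrite /f subrr scale1r raddf0 add0r.
rewrite ltNge -f1E; apply/negP => d1.
have [|u u01 /eqP] := @IVT R (fun u => \det (f u)) 0 1 0 ler01 cf.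
  by rewrite f0E det1 ge_min d1 orbT le_max ler01.
by apply/negP/f0; rewrite in_itv in u01.
Qed.

Lemma posdef_inv_sym n (S : 'M[R]_n) : posdef S -> (invmx S)^T = invmx S.
Proof. by move=> [symS _]; rewrite trmx_inv symS. Qed.

Section Partitioned.
Variables (N a e : nat) (I : 'M[R]_N) (St : 'M[R]_(a, N)) (Se : 'M[R]_(e, N)).
Hypothesis symI : I^T = I.
Hypothesis StSe : St^T *m St + Se^T *m Se = 1%:M.
Let Itt := St *m I *m St^T.
Let Iee := Se *m I *m Se^T.
Let Ite := St *m I *m Se^T.
Let Ieff := Itt - Ite *m invmx Iee *m Ite^T.
Hypotheses (pIee : posdef Iee) (pIeff : posdef Ieff).
Let L := St - Ite *m invmx Iee *m Se.

(** The stationary point [E] is found by block elimination: the Schur complement [Ieff] gives its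
    first block [th], back substitution its second block [et]. Around [E], completing the square in
    the second block leaves the Schur complement as the form in the first. *)
Lemma partitioned_quadratic (b : 'cV[R]_N) :
  let th := invmx Ieff *m L *m b in
  exists (C : R) (h : 'cV[R]_a -> 'cV[R]_e), forall x y,
    ((St^T *m x + Se^T *m y)^T *m b) 0 0 - qform I (St^T *m x + Se^T *m y) / 2 =
    C - qform Ieff (x - th) / 2 - qform Iee (y - h x) / 2.
Proof.
move=> th.
have uee := posdef_unit pIee; have ueff := posdef_unit pIeff.
have symee := posdef_inv_sym pIee.
have IteT : Ite^T = Se *m I *m St^T by rewrite /Ite !trmx_mul trmxK symI mulmxA.
pose et := invmx Iee *m (Se *m b - Ite^T *m th).
pose E := St^T *m th + Se^T *m et.
have IE : I *m E = b.
  have StE : St *m (I *m E) = St *m b.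
    have -> : St *m (I *m E) = Itt *m th + Ite *m et by rewrite /E !mulmxDr !mulmxA.
    have -> : Itt *m th = L *m b + Ite *m invmx Iee *m Ite^T *m th.
      have <- : Ieff *m th = L *m b by rewrite /th !mulmxA mulmxV// mul1mx.
      by rewrite /Ieff mulmxBl subrK.
    rewrite /et mulmxBr mulmxBr !mulmxA /L mulmxBl.
    by rewrite -addrA [X in _ + X]addrCA subrr addr0 subrK.
  have SeE : Se *m (I *m E) = Se *m b.
    have -> : Se *m (I *m E) = Ite^T *m th + Iee *m et by rewrite /E IteT !mulmxDr !mulmxA.
    by rewrite /et (mulmxA Iee) mulmxV// mul1mx addrC subrK.
  by rewrite -[LHS]mul1mx -[RHS]mul1mx -StSe !mulmxDl -!mulmxA StE SeE.
(* The value at the stationary point, and the second block that is optimal for a given first block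
   [x]. *)
exists (qform I E / 2), (fun x => et - invmx Iee *m Ite^T *m (x - th)) => x y.
set z := St^T *m x + Se^T *m y.
have -> : (z^T *m b) 0 0 - qform I z / 2 = qform I E / 2 - qform I (z - E) / 2.
  have := qformD (z - E) E symI; rewrite subrK => ->.
  rewrite -IE.
  have -> : (z^T *m (I *m E)) 0 0 = ((z - E)^T *m I *m E) 0 0 + qform I E.
    have -> : (z - E)^T = z^T - E^T by rewrite linearB.
    by rewrite mulmxBl mulmxBl [X in X + _]mxE [X in _ + X + _]mxE /qform subrK mulmxA.
  by field.
rewrite -[RHS]addrA -opprD -mulrDl; congr (_ - _ / 2).
have -> : z - E = St^T *m (x - th) + Se^T *m (y - et).
  by rewrite /z /E !mulmxBr opprD addrACA.
rewrite qformD//.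
have -> : y - (et - invmx Iee *m Ite^T *m (x - th)) = (y - et) + invmx Iee *m Ite^T *m (x - th).
  by rewrite opprB addrA addrAC.
move: (x - th) (y - et) => {th et E IE z x y} x y.
rewrite (qformD _ _ pIee.1) (qformM I St^T) (qformM I Se^T) !trmxK -/Itt -/Iee.
have -> : qform Ieff x = qform Itt x - qform Iee (invmx Iee *m Ite^T *m x).
  rewrite /Ieff qformB; congr (_ - _); rewrite [RHS]qformM; congr qform.
  by rewrite (trmx_mul (invmx Iee)) trmxK symee mulmxKV// mulmxA.
have -> : (y^T *m Iee *m (invmx Iee *m Ite^T *m x)) 0 0 = (x^T *m Ite *m y) 0 0.
  by rewrite -(mulmxA (invmx Iee)) (mulmxA (y^T *m Iee)) mulmxK// (mulmxA y^T) -bilinear_tr.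
have -> : ((St^T *m x)^T *m I *m (Se^T *m y)) 0 0 = (x^T *m Ite *m y) 0 0.
  by rewrite trmx_mul trmxK /Ite !mulmxA.
by ring.
Qed.

(** With [B = Ite *m invmx Iee] one has [B *m Iee = Ite], so the term quadratic in [B] cancels one
    of the two cross terms and the other completes the Schur complement. *)
Lemma effective_variance : L *m I *m L^T = Ieff.
Proof.
have uee := posdef_unit pIee; have symee := posdef_inv_sym pIee.
have IteT : Ite^T = Se *m I *m St^T by rewrite /Ite !trmx_mul trmxK symI mulmxA.
pose B := Ite *m invmx Iee; have BI : B *m Iee = Ite by rewrite /B mulmxKV.
have BT : L^T = St^T - Se^T *m B^T by rewrite /L linearB /= -/B trmx_mul.
rewrite BT /L -/B.
transitivity ((St *m I *m St^T - St *m I *m Se^T *m B^T)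
    - (B *m (Se *m I *m St^T) - B *m (Se *m I *m Se^T) *m B^T)).
  by rewrite mulmxBl mulmxBl !mulmxBr !mulmxA.
rewrite -/Itt -/Ite -/Iee BI -IteT opprB addrA subrK.
by rewrite /Ieff.
Qed.

End Partitioned.

(** The supremum over [y] is attained at [h x], so the profile is a strictly concave quadratic with
    the single maximiser [th]. Hence [xget] has only one possible choice and does not fall back to
    its default 0. *)
Lemma profile_argmax a e (L : 'cV[R]_a -> 'cV[R]_e -> R) (S : 'M[R]_a) (S' : 'M[R]_e)
    (C : R) (th : 'cV[R]_a) (h : 'cV[R]_a -> 'cV[R]_e) :
  posdef S -> posdef S' ->
  (forall x y, L x y = C - qform S (x - th) / 2 - qform S' (y - h x) / 2) ->
  let P := fun x => ereal_sup [set (L x y)%:E | y in [set: 'cV[R]_e]] in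
  xget 0 [set x | forall x', (P x' <= P x)%E] = th.
Proof.
move=> pS pS' LE P.
have PE x : P x = (C - qform S (x - th) / 2)%:E.
  apply/eqP; rewrite eq_le; apply/andP; split.
    apply: ge_ereal_sup => _ [y _ <-]; rewrite lee_fin LE gerBl divr_ge0//.
    exact: posdef_ge0.
  apply: ereal_sup_ubound; exists (h x) => //; rewrite LE subrr.
  by rewrite qform0 mul0r subr0.
have q0 := qform0 S.
case: xgetP => [x _ /= xmax|/(_ th)/= H].
  have := xmax th; rewrite !PE subrr q0 lee_fin mul0r subr0 lerBrDr gerDl.
  rewrite pmulr_lle0 ?invr_gt0// => /(posdef_le0 pS) /eqP.
  by rewrite subr_eq0 => /eqP.
exfalso; apply: H => x; rewrite !PE subrr q0 mul0r subr0 lee_fin gerBl divr_ge0//.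
exact: posdef_ge0.
Qed.

Lemma ln_gauss_pdf n (mu : 'cV[R]_n) (S : 'M[R]_n) x : posdef S ->
  ln (gauss_pdf mu S x) = ln (Num.sqrt ((2 * pi) ^+ n * \det S))^-1 - qform (invmx S) (x - mu) / 2.
Proof.
move=> pS; rewrite /gauss_pdf lnM ?posrE ?expR_gt0 ?expRK//.
by rewrite invr_gt0 sqrtr_gt0 mulr_gt0 ?posdef_det_gt0// exprn_gt0// mulr_gt0// pi_gt0.
Qed.

End QuadraticForms.

(** * The log-likelihood of the model and its maximiser *)

Section ProfileMLE.
Context {R : realType} {d d0 m m0 q : nat}.
Variables (p : params R d d0 m m0) (c : curves R d d0 q) (k : nat) (t : nat -> R).
Hypothesis pS : forall s, (s < k)%N -> posdef (Sigmas p c t s).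
Hypotheses (pee : posdef (info_ee p c k t)) (peff : posdef (info_eff p c k t)).
Local Notation dq := (\sum_(i < q) d)%N.
Local Notation St := (@Stheta R d q).
Local Notation Se := (@Seta R d q).

Lemma info_sym : (info p c k t)^T = info p c k t.
Proof.
rewrite /info linear_sum; apply: eq_bigr => s _ /=.
apply: tr_sandwich; exact: posdef_inv_sym (pS _).
Qed.

Lemma Stheta_col3 r (x : 'M[R]_(d, r)) (y : 'M[R]_(dq, r)) z :
  St *m col3 x y z = col_mx x z.
Proof.
by rewrite /Stheta mul_col_mx !mul_row_col !mul1mx !mul0mx !addr0 add0r.
Qed.

Lemma Seta_col3 r (x : 'M[R]_(d, r)) (y : 'M[R]_(dq, r)) z : Se *m col3 x y z = y.
Proof. by rewrite /Seta !mul_row_col !mul1mx !mul0mx addr0 add0r. Qed.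

Lemma Stheta_tr_col r (x z : 'M[R]_(d, r)) : St^T *m col_mx x z = col3 x 0 z.
Proof.
rewrite /Stheta tr_col_mx !tr_row_mx !trmx1 !trmx0 mul_row_col !mul_col_mx.
by rewrite !mul1mx !mul0mx !add_col_mx !addr0 add0r.
Qed.

Lemma Seta_tr_mul r (y : 'M[R]_(dq, r)) : Se^T *m y = col3 0 y 0.
Proof. by rewrite /Seta !tr_row_mx !trmx1 !trmx0 !mul_col_mx !mul1mx !mul0mx. Qed.

Lemma Stheta_Seta_decomp (x : 'cV[R]_(d + d)) (y : 'cV[R]_dq) :
  St^T *m x + Se^T *m y = col3 (usubmx x) y (dsubmx x).
Proof.
by rewrite -{1}[x]vsubmxK Stheta_tr_col Seta_tr_mul !add_col_mx !addr0 add0r.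
Qed.

Lemma Stheta_Seta_id : St^T *m St + Se^T *m Se = 1%:M.
Proof.
suff H r (X : 'M[R]_(d + dq + d, r)) : St^T *m (St *m X) + Se^T *m (Se *m X) = X.
  by rewrite -[LHS]mulmx1 mulmxDl -!mulmxA H.
rewrite -[X]vsubmxK -[usubmx X]vsubmxK Stheta_col3 Seta_col3 Stheta_tr_col Seta_tr_mul.
by rewrite !add_col_mx !addr0 add0r.
Qed.

(* The gradient of the log-likelihood at 0. *)
Definition score (x : nat -> 'cV[R]_(d0 + dq + d)) : 'cV[R]_(d + dq + d) :=
  \sum_(s < k) (Hs p c t s)^T *m invmx (Sigmas p c t s) *m (Fs p c t s (x s) - x s.+1).

Lemma loglikE x : exists C, forall E, loglik p c k t x E =
  C + ((E^T *m score x) 0 0 - qform (info p c k t) E / 2).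
Proof.
(* The residual at [E = 0]. It enters [score] with the opposite sign because the mean of a
   transition is [Fs - Hs *m E]. *)
pose r (s : 'I_k) := x s.+1 - Fs p c t s (x s).
pose Lam (s : 'I_k) := invmx (Sigmas p c t s).
exists (\sum_(s < k) (ln (Num.sqrt ((2 * pi) ^+ (d0 + dq + d) * \det (Sigmas p c t s)))^-1
  - qform (Lam s) (r s) / 2)) => E.
have -> : (E^T *m score x) 0 0 = \sum_(s < k) (E^T *m ((Hs p c t s)^T *m Lam s *m (- r s))) 0 0.
  by rewrite /score mulmx_sumr summxE; apply: eq_bigr => s _; rewrite /r opprB.
have -> : qform (info p c k t) E = \sum_(s < k) qform ((Hs p c t s)^T *m Lam s *m Hs p c t s) E.
  by rewrite /qform /info mulmx_sumr mulmx_suml summxE.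
rewrite mulr_suml -sumrB -big_split; apply: eq_bigr => s _ /=.
rewrite /transition ln_gauss_pdf; last exact: pS.
have -> : x s.+1 - (Fs p c t s (x s) - Hs p c t s *m E) = r s + Hs p c t s *m E.
  by rewrite opprB addrCA addrC.
rewrite -/(Lam s) qformD; last exact: posdef_inv_sym (pS _).
have -> : ((r s)^T *m Lam s *m (Hs p c t s *m E)) 0 0 =
    - (E^T *m ((Hs p c t s)^T *m Lam s *m - r s)) 0 0.
  rewrite -[LHS]trmx00 !trmx_mul trmxK (posdef_inv_sym (pS (ltn_ord s))).
  by rewrite mulmxN mulmxN [in RHS]mxE opprK !mulmxA.
by rewrite qformM; field.
Qed.

(** Sends the score to the efficient score: the score for theta minus its regression on the nuisance
    score. *)
Definition score_projection : 'M[R]_(d + d, d + dq + d) :=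
  St - info_te p c k t *m invmx (info_ee p c k t) *m Se.

(** Replaces the choice of a maximiser by a formula that is affine in the samples, from which
    measurability and the law can be read off. *)
Lemma profile_mleE x :
  profile_mle p c k t x = invmx (info_eff p c k t) *m score_projection *m score x.
Proof.
have [C1 LE] := loglikE x.
have [C2 [h QE]] := partitioned_quadratic info_sym Stheta_Seta_id pee peff (score x).
apply: (@profile_argmax _ _ _ (fun th et => loglik p c k t x (col3 (usubmx th) et (dsubmx th)))
  (info_eff p c k t) (info_ee p c k t) (C1 + C2) _ h) => // th et.
by rewrite -Stheta_Seta_decomp LE QE !addrA.
Qed.

Lemma score_projection_variance :
  score_projection *m info p c k t *m score_projection^T = info_eff p c k t.
Proof. exact: effective_variance info_sym pee. Qed.

(** The nuisance part drops out because [info_te *m invmx info_ee *m info_ee = info_te]. *)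
Lemma score_projection_theta (x : 'cV[R]_(d + d)) (y : 'cV[R]_dq) :
  score_projection *m (info p c k t *m (St^T *m x + Se^T *m y)) = info_eff p c k t *m x.
Proof.
have uee := posdef_unit pee.
have etE : Se *m info p c k t *m St^T = info_et p c k t.
  by rewrite /info_et /info_te !trmx_mul trmxK info_sym mulmxA.
transitivity (info_tt p c k t *m x + info_te p c k t *m y
  - info_te p c k t *m invmx (info_ee p c k t) *m (info_et p c k t *m x + info_ee p c k t *m y)).
  by rewrite /score_projection mulmxBl !mulmxDr -etE !mulmxA.
rewrite mulmxDr [X in _ - (_ + X)]mulmxA mulmxKV// opprD addrACA subrr addr0.
by rewrite mulmxA -mulmxBl.
Qed.

End ProfileMLE.

(** * The law of the estimation error *)

(** The approximating laws are those of [sqrt (v_ n) * Z] for a single standard normal [Z], which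
    converges pointwise, also when the limit variance is 0. *)
Lemma normal_limit (R : realType) d (T : measurableType d) (P : probability T R)
    (S_ : (T -> R)^nat) (S : T -> R) (v_ : R^nat) (v : R) :
  (forall n, measurable_fun setT (S_ n)) -> measurable_fun setT S ->
  (forall n, 0 <= v_ n) -> v_ @ \oo --> v ->
  {ae P, forall x, S_ ^~ x @ \oo --> S x} ->
  (forall n B, measurable B -> P (S_ n @^-1` B) = normal_law 0 (v_ n) B) ->
  forall B, measurable B -> P (S @^-1` B) = normal_law 0 v B.
Proof.
move=> mS_ mS v_0 v_v S_S lS B mB.
have v0 : 0 <= v.
  rewrite -(cvg_lim _ v_v)//; apply: limr_ge; first by apply/cvg_ex; exists v.
  exact: nearW.
have msq (a : R) : measurable_fun setT (fun x : measurableTypeR R => Num.sqrt a * x + 0 : R).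
  by apply: measurable_funD => //; exact: measurable_funM.
rewrite normal_lawE//.
apply: (@law_limit _ _ _ _ _ _ (normal_prob 0 1) S_ (fun n x => Num.sqrt (v_ n) * x + 0) S
  (fun x => Num.sqrt v * x + 0)) => //.
  apply: nearW => x; apply: cvgD; last exact: cvg_cst.
  apply: cvgM; last exact: cvg_cst.
  by apply: continuous_cvg => //; exact: sqrt_continuous.
by move=> n C mC; rewrite lS// normal_lawE.
Qed.

Lemma sum_mul_ord (V : nmodType) k n (F : nat -> V) :
  \sum_(j < k * n) F j = \sum_(s < k) \sum_(i < n) F (s * n + i)%N.
Proof.
elim: k => [|k IH]; first by rewrite mul0n !big_ord0.
by rewrite big_ord_recr/= -IH mulSnr big_split_ord.
Qed.

(** * Continuity in time of the coefficients of the model *)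

Section CurveContinuity.
Context {R : realType} {d d0 m m0 q : nat}.
Variables (T : R) (p : params R d d0 m m0) (c : curves R d d0 q).
Hypotheses (T0 : 0 < T) (cP_ : mcont 0 T (cP c)) (cPx_ : mcont 0 T (cPx c)).
Hypotheses (cGG_ : mcont 0 T (cGG c)) (cPhi_ : mcont 0 T (cPhi c)).
Hypothesis oPhix : solves_Phix p c T.
Hypothesis oPsi : solves_Psi p c T.

(** Follows the syntax of the matrix expression. The constant case comes first, so time-independent
    subterms are closed whole; the remaining leaves are looked up among the hypotheses. *)
Ltac mcont_tac := repeat
    lazymatch goal with
    | |- mcont _ _ (fun _ => ?e) => exact (@mcont_cst _ _ _ _ _ e)
    | |- mcont _ _ (fun u => row_mx (@?f u) (@?g u)) => refine (@mcont_row _ _ _ _ _ _ f g _ _)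
    | |- mcont _ _ (fun u => col_mx (@?f u) (@?g u)) => refine (@mcont_col _ _ _ _ _ _ f g _ _)
    | |- mcont _ _ (fun u => @?f u *m @?g u) => refine (@mcontM _ _ _ _ _ _ f g _ _)
    | |- mcont _ _ (fun u => @?f u - @?g u) => refine (@mcontB _ _ _ _ _ f g _ _)
    | |- mcont _ _ (fun u => @?f u + @?g u) => refine (@mcontD _ _ _ _ _ f g _ _)
    | |- mcont _ _ (fun u => - @?f u) => refine (@mcontN _ _ _ _ _ f _)
    | |- mcont _ _ (fun u => lsubmx (@?f u)) => refine (@mcont_lsub _ _ _ _ _ _ f _)
    | |- mcont _ _ (fun u => rsubmx (@?f u)) => refine (@mcont_rsub _ _ _ _ _ _ f _)
    | |- mcont _ _ (fun u => usubmx (@?f u)) => refine (@mcont_usub _ _ _ _ _ _ f _)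
    | |- mcont _ _ (fun u => dsubmx (@?f u)) => refine (@mcont_dsub _ _ _ _ _ _ f _)
    | |- mcont _ _ (fun u => \mxdiag_(i < _) (@?f u)) => refine (@mcont_mxdiag _ _ _ _ _ f _)
    | |- mcont _ _ _ => assumption
    end.

Lemma P11_mcont : mcont 0 T (fun t => P11 (cP c t)).
Proof. rewrite /P11 /ulsubmx; mcont_tac. Qed.
Lemma P12_mcont : mcont 0 T (fun t => P12 (cP c t)).
Proof. rewrite /P12 /ursubmx; mcont_tac. Qed.
Lemma P31_mcont : mcont 0 T (fun t => P31 (cP c t)).
Proof. rewrite /P31; mcont_tac. Qed.
Lemma P32_mcont : mcont 0 T (fun t => P32 (cP c t)).
Proof. rewrite /P32; mcont_tac. Qed.
Lemma A22_mcont : mcont 0 T (A22 p c).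
Proof. have cP32 := @P32_mcont; rewrite /A22; mcont_tac. Qed.
Lemma GMP31_mcont : mcont 0 T (GMP31 p c).
Proof. have cP31 := @P31_mcont; rewrite /GMP31; mcont_tac. Qed.
Lemma MPdiff_mcont : mcont 0 T (MPdiff p c).
Proof. have cP32 := @P32_mcont; rewrite /MPdiff; mcont_tac. Qed.

Lemma AA2_mcont : mcont 0 T (AA2 p c).
Proof.
have c11 := @P11_mcont; have c12 := @P12_mcont; have cG := @GMP31_mcont.
have cM := @MPdiff_mcont; have cA := @A22_mcont.
by rewrite /AA2 /a1 /diagq; mcont_tac.
Qed.

Lemma beta0_mcont : mcont 0 T (beta0 p c).
Proof. by rewrite /beta0 /GG1 /GG3; mcont_tac. Qed.

Lemma Phix_unit t : 0 <= t <= T -> cPhix c t \in unitmx.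
Proof. by case: oPhix => o1 o2; exact: (fundamental_unit (@A22_mcont) o1 o2). Qed.

Lemma Psi_unit t : 0 <= t <= T -> cPsi c t \in unitmx.
Proof. by case: oPsi => o1 o2; exact: (fundamental_unit (@AA2_mcont) o1 o2). Qed.

Lemma Psi_mcont : mcont 0 T (cPsi c).
Proof. by case: oPsi => /ode_mcont. Qed.

Lemma Psi_inv_mcont : mcont 0 T (fun t => invmx (cPsi c t)).
Proof. by apply: mcont_inv (@Psi_mcont) _ => t; exact: Psi_unit. Qed.

(** Its blocks contain [MM0] and [MMbar], which are primitives of integrands involving the inverse
    of [cPhix]; hence the appeal to invertibility and to continuity of primitives. *)
Lemma KK0_mcont : mcont 0 T (KK0 p c).
Proof.
have cG := @GMP31_mcont; have cM := @MPdiff_mcont.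
have cPhix_ : mcont 0 T (cPhix c) by case: oPhix => /ode_mcont.
have cPhixV : mcont 0 T (fun t => invmx (cPhix c t)).
  by apply: mcont_inv => // t; exact: Phix_unit.
have c12 : mcont 0 T (fun t => Phi12 (cPhi c t)) by rewrite /Phi12 /ursubmx /ulsubmx; mcont_tac.
have c13 : mcont 0 T (fun t => Phi13 (cPhi c t)) by rewrite /Phi13 /ursubmx /ulsubmx; mcont_tac.
have c22 : mcont 0 T (fun t => Phi22 (cPhi c t)) by rewrite /Phi22 /drsubmx /ulsubmx; mcont_tac.
have c23 : mcont 0 T (fun t => Phi23 (cPhi c t)) by rewrite /Phi23 /ursubmx /ulsubmx; mcont_tac.
have c42 : mcont 0 T (fun t => Phi42 (cPhi c t)) by rewrite /Phi42 /dlsubmx; mcont_tac.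
have c43 : mcont 0 T (fun t => Phi43 (cPhi c t)) by rewrite /Phi43 /dlsubmx; mcont_tac.
have cMM0 : mcont 0 T (MM0 p c).
  by apply: mcont_primitive; [exact: ltW|mcont_tac].
have cMMbar : mcont 0 T (MMbar p c).
  by apply: mcont_primitive; [exact: ltW|mcont_tac].
by rewrite /KK0 /k1 /K1 /K1bar /diagq; mcont_tac.
Qed.

Local Notation dq := (\sum_(i < q) d)%N.
Local Notation N := (d0 + dq + d)%N.

(** * The noise of one observation step *)

Section Step.
Variables (E : 'cV[R]_(d + dq + d)) (a b : R) (cc : 'rV[R]_N).
Hypotheses (a0 : 0 <= a) (ab : a < b) (bT : b <= T).

(* cc *m noise is the Wiener integral of kernel_row u *m DD0 over [a, b]. *)
Definition kernel_row (u : R) : 'rV[R]_N := cc *m cPsi c b *m invmx (cPsi c u).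

Lemma kernel_row_mcont : mcont a b kernel_row.
Proof.
apply: mcontM; first exact: mcont_cst.
by apply: mcontS (@Psi_inv_mcont).
Qed.

Lemma kernel_row_integral x y : a <= x -> x <= y -> y <= b ->
  kernel_row y - kernel_row x = - mx_integral x y (fun u => kernel_row u *m AA2 p c u).
Proof.
move=> ax xy yb; case: oPsi => o1 o2.
rewrite /kernel_row -mulmxBr (fundamental_inv_integral (@AA2_mcont) o1 o2 (le_trans a0 ax) xy
  (le_trans yb bT)).
rewrite mulmxN mx_integralMl.
  by congr (- _); apply: mx_integral_ext => u _; rewrite !mulmxA.
apply: mcontS (le_trans a0 ax) (le_trans yb bT) _.
by apply: mcontM; [exact: Psi_inv_mcont|exact: AA2_mcont].
Qed.

Lemma kernel_rowb : kernel_row b = cc.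
Proof. by rewrite /kernel_row mulmxK// Psi_unit// (le_trans a0 (ltW ab)). Qed.

(** At [a = t s], [b = t s.+1] this is by conversion the residual [x s.+1 - Fs s (x s) + Hs s *m E];
    stated with free endpoints, it can be studied on a single interval. *)
Definition noise (Xa Xb : 'cV[R]_N) : 'cV[R]_N :=
  Xb - (cPsi c b *m invmx (cPsi c a) *m Xa +
    cPsi c b *m mx_integral a b (fun u => invmx (cPsi c u) *m beta0 p c u)) +
  cPsi c b *m mx_integral a b (fun u => invmx (cPsi c u) *m KK0 p c u) *m E.

(** Scalar integration by parts is applied in each coordinate. The derivative of the kernel is
    chosen so that the term [AA2 *m X] cancels, and the limit depends on the path only through its
    values at [a] and [b]. *)
Lemma noise_limit (X : R -> 'cV[R]_N) (W : R -> 'cV[R]_(d0 + dq)) :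
  mcont a b X ->
  (forall x y, a <= x -> x <= y -> y <= b -> X y - X x =
    mx_integral x y (fun u => AA2 p c u *m X u + beta0 p c u - KK0 p c u *m E)
    + DD0 (q:=q) p *m (W y - W x)) ->
  \sum_(i < n.+1) (kernel_row (grid a b n.+1 i) *m DD0 (q:=q) p *m
     (W (grid a b n.+1 i.+1) - W (grid a b n.+1 i))) 0 0
    @[n --> \oo] --> (cc *m noise (X a) (X b)) 0 0.
Proof.
move=> cX XE.
have cS M' N' (f : R -> 'M[R]_(M', N')) : mcont 0 T f -> mcont a b f by apply: mcontS.
have cA := cS _ _ _ (@AA2_mcont); have cb := cS _ _ _ (@beta0_mcont).
have cK := cS _ _ _ (@KK0_mcont); have cp := @kernel_row_mcont.
have cPV := cS _ _ _ (@Psi_inv_mcont).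
pose f u := beta0 p c u - KK0 p c u *m E.
have cf : mcont a b f by rewrite /f; mcont_tac.
pose h u := AA2 p c u *m X u + f u.
have ch : mcont a b h by rewrite /h; mcont_tac.
pose g u := kernel_row u *m AA2 p c u.
have cg : mcont a b g by rewrite /g; mcont_tac.
(* Absorbing [DD0] into the driving path makes each coordinate of [X] a scalar equation driven by
   one coordinate of [w]. *)
pose w u := DD0 (q:=q) p *m W u.
have H (l : 'I_N) : \sum_(i < n.+1) kernel_row (grid a b n.+1 i) 0 l *
    (w (grid a b n.+1 i.+1) l 0 - w (grid a b n.+1 i) l 0) @[n --> \oo] -->
    kernel_row b 0 l * X b l 0 - kernel_row a 0 l * X a l 0 -
    segint a b (fun u => kernel_row u 0 l * h u l 0 - g u 0 l * X u l 0).
  apply: (@wiener_sum_by_parts R a b (fun u => kernel_row u 0 l) (fun u => g u 0 l)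
    (fun u => X u l 0) (fun u => h u l 0) (fun u => w u l 0) (ltW ab)).
  - exact: cp.
  - exact: cg.
  - exact: cX.
  - exact: ch.
  - move=> x y ax xy yb; have /matrixP/(_ 0 l) := kernel_row_integral ax xy yb.
    by rewrite mxE [X in _ + X]mxE [in RHS]mxE mx_integralE.
  - move=> x y ax xy yb; have /matrixP/(_ l 0) := XE x y ax xy yb.
    rewrite mxE [X in _ + X]mxE [in RHS]mxE mx_integralE => ->; congr (_ + _).
      by apply: segint_ext => u _; rewrite /h /f addrA.
    by rewrite /w mulmxBr mxE [X in _ + X]mxE.
have sumE n : \sum_(i < n.+1) (kernel_row (grid a b n.+1 i) *m DD0 (q:=q) p *m
     (W (grid a b n.+1 i.+1) - W (grid a b n.+1 i))) 0 0 =
  \sum_(l < N) \sum_(i < n.+1) kernel_row (grid a b n.+1 i) 0 l *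
    (w (grid a b n.+1 i.+1) l 0 - w (grid a b n.+1 i) l 0).
  rewrite exchange_big; apply: eq_bigr => i _.
  rewrite -mulmxA mxE; apply: eq_bigr => l _.
  by rewrite mulmxBr; congr (_ * _); rewrite [LHS]mxE [X in _ + X = _]mxE.
rewrite (_ : (fun n => _) = (fun n => \sum_(l < N) \sum_(i < n.+1) kernel_row (grid a b n.+1 i) 0 l *
    (w (grid a b n.+1 i.+1) l 0 - w (grid a b n.+1 i) l 0))); last exact/funext.
have limE : cc *m noise (X a) (X b) = kernel_row b *m X b - kernel_row a *m X a -
    mx_integral a b (fun u => kernel_row u *m h u - g u *m X u).
  have -> : mx_integral a b (fun u => kernel_row u *m h u - g u *m X u) =
      cc *m cPsi c b *m mx_integral a b (fun u => invmx (cPsi c u) *m beta0 p c u) -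
      cc *m cPsi c b *m mx_integral a b (fun u => invmx (cPsi c u) *m KK0 p c u) *m E.
    rewrite -(mulmxA _ _ E) mx_integralMr; last by mcont_tac.
    rewrite !mx_integralMl; [|by mcont_tac..].
    rewrite -mx_integralB; [|by mcont_tac..].
    apply: mx_integral_ext => u _.
    by rewrite /h /g /f mulmxDr mulmxA addrAC addrN add0r mulmxBr /kernel_row !mulmxA.
  by rewrite /noise kernel_rowb /kernel_row mulmxDr mulmxBr mulmxDr !mulmxA !opprD opprK !addrA.
have -> : (cc *m noise (X a) (X b)) 0 0 =
  \sum_(l < N) (kernel_row b 0 l * X b l 0 - kernel_row a 0 l * X a l 0 -
    segint a b (fun u => kernel_row u 0 l * h u l 0 - g u 0 l * X u l 0)).
  rewrite limE mxE [X in X + _]mxE [X in _ + X + _]mxE [X in _ + X]mxE mx_integralE !sumrB.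
  congr (_ - _ - _); rewrite ?mxE//.
  rewrite -segint_sum.
    by apply: segint_ext => u _; rewrite mxE [X in _ + X]mxE !mxE sumrB.
  by move=> l; apply: cont_onB; apply: cont_onM.
by apply: cvg_big => [|l _]; [exact: add_continuous|exact: H].
Qed.

(** The variances of the approximating sums are Riemann sums of the squared norm of
    [kernel_row u *m DD0], whose integral is the quadratic form of the step covariance at [cc]. *)
Lemma kernel_variance_limit :
  \sum_(i < n.+1) (grid a b n.+1 i.+1 - grid a b n.+1 i) *
     (kernel_row (grid a b n.+1 i) *m DD0 (q:=q) p *m
      (kernel_row (grid a b n.+1 i) *m DD0 (q:=q) p)^T) 0 0
    @[n --> \oo] -->
  (cc *m (cPsi c b *m mx_integral a b (fun u =>
     invmx (cPsi c u) *m DD0 (q:=q) p *m (DD0 (q:=q) p)^T *m (invmx (cPsi c u))^T) *m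
   (cPsi c b)^T) *m cc^T) 0 0.
Proof.
have cp := @kernel_row_mcont.
have cPV : mcont a b (fun t => invmx (cPsi c t)) by apply: mcontS (@Psi_inv_mcont).
pose h u := kernel_row u *m DD0 (q:=q) p.
have ch : mcont a b h by rewrite /h; mcont_tac.
have chT : mcont a b (fun u => (h u)^T) by exact: mcont_tr.
have chh : mcont a b (fun u => h u *m (h u)^T) by mcont_tac.
have cPVT : mcont a b (fun t => (invmx (cPsi c t))^T) by exact: mcont_tr.
rewrite !mulmxA -(mulmxA _ _ cc^T) -(mulmxA cc) -trmx_mul mulmxA.
rewrite mx_integralMl; last by mcont_tac.
rewrite mx_integralMr; last by mcont_tac.
rewrite mx_integralE.
rewrite (segint_ext (g := fun u => (h u *m (h u)^T) 0 0)); last first.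
  by move=> u _; rewrite /h /kernel_row !trmx_mul !mulmxA.
exact: (riemann_sum (ltW ab) (@chh 0 0)).
Qed.

End Step.

(** * Joint law of the noises over all observation steps *)

Section Samples.
Context {disp : measure_display} {Om : measurableType disp} {Pr : probability Om R}.
Variables (W0 : R -> Om -> 'cV[R]_d0) (Wobs : 'I_q -> R -> Om -> 'cV[R]_d).
Variables (E : 'cV[R]_(d + dq + d)) (x0 : 'cV[R]_N) (X : R -> Om -> 'cV[R]_N).
Variables (k : nat) (t : nat -> R).
Local Notation W := (fun s w => col_mx (W0 s w) (\mxcol_(i < q) Wobs i s w)).
Hypothesis bW0 : brownian_motion Pr T W0.
Hypothesis bWobs : forall i, brownian_motion Pr T (Wobs i).
Hypothesis indep : mutually_independent Pr
    (fun i : option 'I_q =>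
       if i is Some j then sigma_process T (Wobs j) else sigma_process T W0).
Hypothesis obs : observed_process p c Pr T E x0 W X.
Hypotheses (t0 : t 0%N = 0) (tT : t k <= T).
Hypothesis tS : forall s, (s < k)%N -> t s < t s.+1.

Lemma sample_time s : (s <= k)%N -> 0 <= t s <= T.
Proof. by move=> sk; apply: (partition_itv (N := k)) => //; rewrite t0. Qed.

Lemma sample_random_vector s : (s <= k)%N -> random_vector (X (t s)).
Proof. by move=> sk; case: obs => + _; apply; rewrite in_itv/= sample_time. Qed.

Lemma noise_measurable s (u : 'rV[R]_N) : (s < k)%N -> measurable_fun setT
  (fun w => (u *m noise E (t s) (t s.+1) (X (t s) w) (X (t s.+1) w)) 0 0).
Proof.
move=> sk; have := @sample_random_vector s (ltnW sk); have := @sample_random_vector s.+1 sk.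
rewrite /noise; move: (mx_integral _ _ _) => h; move: (_ *m _ *m E) => C rb ra.
rewrite (_ : (fun w => _) = (fun w => ((u^T)^T *m X (t s.+1) w) 0 0 -
  (((u *m (cPsi c (t s.+1) *m invmx (cPsi c (t s))))^T)^T *m X (t s) w) 0 0 +
  (u *m (C - cPsi c (t s.+1) *m h)) 0 0)); last first.
  apply/funext => w; rewrite !trmxK -(mulmxA u _ (X _ _)).
  have sp (x y z v : 'M[R]_1) : (x - (y + z) + v) 0 0 = x 0 0 - y 0 0 + (v - z) 0 0.
    by rewrite !mxE; ring.
  rewrite [u *m (_ - _ + _)]mulmxDr [u *m (X _ _ - _)]mulmxBr [u *m (_ *m X _ _ + _)]mulmxDr sp.
  by rewrite [u *m (C - _)]mulmxBr.
apply: measurable_funD => //; apply: measurable_funB; exact: random_vector_linear.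
Qed.

Lemma process_increment w : mcont 0 T (X ^~ w) ->
  {in `[0, T], forall t, X t w = x0
        + mx_integral 0 t (fun s => AA2 p c s *m X s w + beta0 p c s - KK0 p c s *m E)
        + DD0 (q:=q) p *m (W t w - W 0 w)} ->
  forall x y, 0 <= x -> x <= y -> y <= T -> X y w - X x w =
    mx_integral x y (fun u => AA2 p c u *m X u w + beta0 p c u - KK0 p c u *m E)
    + DD0 (q:=q) p *m (W y w - W x w).
Proof.
move=> cX XE x y x0' xy yT.
have cA := @AA2_mcont; have cb := @beta0_mcont; have cK := @KK0_mcont.
have cf : mcont 0 T (fun u => AA2 p c u *m X u w + beta0 p c u - KK0 p c u *m E) by mcont_tac.
rewrite !XE; [|by rewrite in_itv/= x0' (le_trans xy)|by rewrite in_itv/= yT (le_trans x0')].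
have -> := @mx_integral_chasles _ _ _ 0 x y (fun u => AA2 p c u *m X u w + beta0 p c u - KK0 p c u *m E).
- rewrite !mulmxBr; move: (mx_integral 0 x _) (mx_integral x y _) => I J.
  move: (_ *m W 0 w) (_ *m W x w) (_ *m W y w) => U V Z.
  by apply/matrixP => i j; rewrite !mxE; ring.
- by rewrite x0'.
- by apply: mcontS cf.
Qed.

(** All steps are refined at once into one partition of [0, t k]. A combination of the noises of
    different steps is then the limit of a single Brownian sum, and its variance is the sum of the
    variances of the steps. *)
Lemma sample_noise_law (cs : nat -> 'rV[R]_N) (B : set R) : measurable B ->
  Pr ((fun w => \sum_(s < k) (cs s *m noise E (t s) (t s.+1) (X (t s) w) (X (t s.+1) w)) 0 0) @^-1` B) =
  normal_law 0 (\sum_(s < k) (cs s *m Sigmas p c t s *m (cs s)^T) 0 0) B.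
Proof.
(* Each step is cut into n.+1 cells, and j = s * n.+1 + i numbers cell i of
   step s. *)
pose r n j := grid (t (j %/ n.+1)%N) (t (j %/ n.+1)%N.+1) n.+1 (j %% n.+1).
have rE n s i : (i < n.+1)%N -> r n (s * n.+1 + i)%N = grid (t s) (t s.+1) n.+1 i.
  by move=> iN; rewrite /r divnMDl// modnMDl divn_small// addn0 modn_small.
have rSE n s i : (i < n.+1)%N -> r n (s * n.+1 + i).+1 = grid (t s) (t s.+1) n.+1 i.+1.
  move=> iN; rewrite -addnS; have [iN'|] := ltnP i.+1 n.+1; first by rewrite rE.
  move=> Ni; have -> : i.+1 = n.+1 by apply/eqP; rewrite eqn_leq iN Ni.
  (* The right end of the last cell of step [s] is numbered as the left end of cell 0 of step
     [s + 1]; both are [t s.+1]. *)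
  by rewrite -mulSnr -[(_ * _)%N]addn0 rE// grid0 gridn.
pose al n j := kernel_row (t (j %/ n.+1)%N.+1) (cs (j %/ n.+1)%N) (r n j) *m DD0 (q:=q) p.
have alE n s i : (i < n.+1)%N ->
    al n (s * n.+1 + i)%N = kernel_row (t s.+1) (cs s) (grid (t s) (t s.+1) n.+1 i) *m DD0 (q:=q) p.
  by move=> iN; rewrite /al rE// divnMDl// divn_small// addn0.
have r0 n : 0 <= r n 0%N.
  by rewrite /r div0n mod0n grid0 t0.
(* The final index has quotient [k] and remainder 0, so it evaluates to [t k] whatever the value of
   [t k.+1]. *)
have rT n : r n (k * n.+1)%N <= T by rewrite -[(_ * _)%N]addn0 rE// grid0.
have rS n j : (j < k * n.+1)%N -> r n j < r n j.+1.
  move=> jk; rewrite {1 2}(divn_eq j n.+1) rE ?rSE ?ltn_mod//.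
  by apply: grid_lt; apply: tS; rewrite ltn_divLR.
pose S_ n w := \sum_(j < k * n.+1) (al n j *m (W (r n j.+1) w - W (r n j) w)) 0 0.
pose v_ n := \sum_(j < k * n.+1) (r n j.+1 - r n j) * (al n j *m (al n j)^T) 0 0.
have law n := brownian_family_sum_law (r0 n) (rT n) (rS n) (al n) bW0 bWobs indep.
apply: (normal_limit (S_ := S_) (v_ := v_)).
- by move=> n; case: (law n).
- by apply: measurable_sum => s; exact: noise_measurable.
- move=> n; apply: sumr_ge0 => j _; rewrite mulr_ge0//.
    by rewrite subr_ge0 ltW// rS.
  by rewrite mxE sumr_ge0// => i _; rewrite [X in _ * X]mxE -expr2 sqr_ge0.
- rewrite (_ : v_ = fun n => \sum_(s < k) \sum_(i < n.+1)
    (grid (t s) (t s.+1) n.+1 i.+1 - grid (t s) (t s.+1) n.+1 i) *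
     (kernel_row (t s.+1) (cs s) (grid (t s) (t s.+1) n.+1 i) *m DD0 (q:=q) p *m
     (kernel_row (t s.+1) (cs s) (grid (t s) (t s.+1) n.+1 i) *m DD0 (q:=q) p)^T) 0 0); last first.
    apply/funext => n.
    rewrite /v_ (sum_mul_ord _ _ (fun j => (r n j.+1 - r n j) * (al n j *m (al n j)^T) 0 0)).
    apply: eq_bigr => s _; apply: eq_bigr => i _.
    by rewrite rE// rSE// alE.
  apply: cvg_big => [|s _]; first exact: add_continuous.
  have /andP[ts0 _] := sample_time (ltnW (ltn_ord s)).
  have /andP[_ tsT] := sample_time (ltn_ord s).
  exact: (@kernel_variance_limit _ _ (cs s) ts0 (tS (ltn_ord s)) tsT).
- case: obs => _ /filterS; apply => w [/within_mcont cXw XE].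
  have dX := process_increment cXw XE.
  rewrite (_ : (fun n => _) = fun n => \sum_(s < k) \sum_(i < n.+1)
    (kernel_row (t s.+1) (cs s) (grid (t s) (t s.+1) n.+1 i) *m DD0 (q:=q) p *m
     (W (grid (t s) (t s.+1) n.+1 i.+1) w - W (grid (t s) (t s.+1) n.+1 i) w)) 0 0); last first.
    apply/funext => n.
    rewrite /S_ (sum_mul_ord _ _ (fun j => (al n j *m (W (r n j.+1) w - W (r n j) w)) 0 0)).
    apply: eq_bigr => s _; apply: eq_bigr => i _.
    by rewrite rE// rSE// alE.
  apply: cvg_big => [|s _]; first exact: add_continuous.
  have /andP[ts0 _] := sample_time (ltnW (ltn_ord s)).
  have /andP[_ tsT] := sample_time (ltn_ord s).
  apply: (@noise_limit E _ _ (cs s) ts0 (tS (ltn_ord s)) tsT (X ^~ w) (W ^~ w)).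
    by apply: mcontS cXw.
  by move=> x y tx xy yt; apply: dX => //; [exact: le_trans tx|exact: le_trans tsT].
- by move=> n C mC; case: (law n) => _ /(_ C mC).
Qed.

End Samples.

End CurveContinuity.

(** * The estimation error as a combination of the noises *)

Section EstimationError.
Context {R : realType} {d d0 m m0 q : nat}.
Variables (p : params R d d0 m m0) (c : curves R d d0 q) (k : nat) (t : nat -> R).
Hypothesis pS : forall s, (s < k)%N -> posdef (Sigmas p c t s).
Hypotheses (pee : posdef (info_ee p c k t)) (peff : posdef (info_eff p c k t)).
Local Notation dq := (\sum_(i < q) d)%N.

(** The minus sign comes from [score - info *m E], which is minus the weighted sum of the
    residuals. *)
Definition error_weight (u : 'cV[R]_(d + d)) (s : nat) : 'rV[R]_(d0 + dq + d) :=
  - (u^T *m invmx (info_eff p c k t) *m score_projection p c k t *m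
     (Hs p c t s)^T *m invmx (Sigmas p c t s)).

Lemma estimation_errorE (x : nat -> 'cV[R]_(d0 + dq + d)) (th : 'cV[R]_(d + d))
    (y : 'cV[R]_dq) (u : 'cV[R]_(d + d)) :
  (u^T *m (profile_mle p c k t x - th)) 0 0 =
  \sum_(s < k) (error_weight u s *m (x s.+1 - Fs p c t s (x s) +
     Hs p c t s *m col3 (usubmx th) y (dsubmx th))) 0 0.
Proof.
set E := col3 _ _ _.
have thE : th = invmx (info_eff p c k t) *m score_projection p c k t *m (info p c k t *m E).
  by rewrite -mulmxA /E -Stheta_Seta_decomp score_projection_theta// mulKmx// posdef_unit.
rewrite profile_mleE// {1}thE -mulmxBr mulmxA mulmxA.
have -> : score p c k t x - info p c k t *m E = - \sum_(s < k)
    (Hs p c t s)^T *m invmx (Sigmas p c t s) *m (x s.+1 - Fs p c t s (x s) + Hs p c t s *m E).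
  rewrite /score /info mulmx_suml -sumrB -sumrN; apply: eq_bigr => s _.
  have factor (A' : 'M[R]_(d + dq + d, d0 + dq + d)) H (f z : 'cV[R]_(d0 + dq + d)) :
      A' *m (f - z) - A' *m H *m E = - (A' *m (z - f + H *m E)).
    by rewrite -(mulmxA A') -mulmxBr -[RHS]mulmxN !opprD opprK [- z + _]addrC.
  exact: factor.
rewrite mulmxN mulmx_sumr -sumrN summxE; apply: eq_bigr => s _.
by rewrite /error_weight !mulmxA mulNmx.
Qed.

(** Each weight ends in [invmx Sigmas], and one of the two copies cancels the covariance of the
    step; the remaining terms add up to [info] between two copies of [L]. *)
Lemma error_variance (u : 'cV[R]_(d + d)) :
  \sum_(s < k) (error_weight u s *m Sigmas p c t s *m (error_weight u s)^T) 0 0 =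
  qform (invmx (info_eff p c k t)) u.
Proof.
have symeff := posdef_inv_sym peff.
pose L := u^T *m invmx (info_eff p c k t) *m score_projection p c k t.
have -> : \sum_(s < k) (error_weight u s *m Sigmas p c t s *m (error_weight u s)^T) 0 0 =
    (L *m info p c k t *m L^T) 0 0.
  rewrite /info mulmx_sumr mulmx_suml summxE; apply: eq_bigr => s _.
  have uS := posdef_unit (pS (ltn_ord s)).
  rewrite /error_weight -/L linearN/= mulNmx mulmxN mulNmx opprK.
  have symS := posdef_inv_sym (pS (ltn_ord s)).
  move: (Sigmas p c t s) (Hs p c t s) L uS symS => S H {}L uS symS.
  by rewrite !trmx_mul trmxK symS !mulmxA mulmxKV.
rewrite /L !trmx_mul trmxK symeff -!mulmxA.
rewrite [X in invmx _ *m X]mulmxA.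
rewrite [X in invmx _ *m X]mulmxA score_projection_variance//.
by rewrite mulKmx ?posdef_unit// /qform mulmxA.
Qed.

End EstimationError.

Theorem theorem6p2 (R : realType) (d d0 m m0 q : nat)
  (T : R) (p : params R d d0 m m0) (c : curves R d d0 q)
  (disp : measure_display) (Om : measurableType disp) (Pr : probability Om R)
  (W0 : R -> Om -> 'cV[R]_d0) (Wobs : 'I_q -> R -> Om -> 'cV[R]_d)
  (x00 : 'cV[R]_d0) (x0obs : 'I_q -> 'cV[R]_d) (z0 : 'cV[R]_d)
  (e0 : 'cV[R]_d) (eobs : 'I_q -> 'cV[R]_d) (ebar : 'cV[R]_d)
  (X : R -> Om -> 'cV[R]_(d0 + \sum_(i < q) d + d))
  (k : nat) (t : nat -> R) (tau : R) :
  0 < T ->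
  admissible p ->
  riccati_P T p (cP c) ->
  (forall P', riccati_P T p P' -> {in `[0, T], P' =1 cP c}) ->
  riccati_Px T p (cPx c) ->
  (forall Px', riccati_Px T p Px' -> {in `[0, T], Px' =1 cPx c}) ->
  solves_GG T p (cP c) (cGG c) ->
  solves_Phi p c T ->
  solves_Phix p c T ->
  solves_Psi p c T ->
  brownian_motion Pr T W0 ->
  (forall i, brownian_motion Pr T (Wobs i)) ->
  mutually_independent Pr
    (fun i : option 'I_q =>
       if i is Some j then sigma_process T (Wobs j) else sigma_process T W0) ->
  observed_process p c Pr T
    (col3 e0 (\mxcol_(i < q) eobs i) ebar)
    (col3 x00 (\mxcol_(i < q) x0obs i) (z0 + e0))
    (fun s w => col_mx (W0 s w) (\mxcol_(i < q) Wobs i s w)) X ->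
  t 0%N = 0 ->
  (forall s, (s < k)%N -> t s < t s.+1) ->
  t k = tau ->
  tau < T ->
  (forall s, (s < k)%N -> posdef (Sigmas p c t s)) ->
  posdef (info_ee p c k t) ->
  posdef (info_eff p c k t) ->
  gaussian_vector Pr
    (fun w => profile_mle p c k t (fun s => X (t s) w) - col_mx e0 ebar)
    0 (invmx (info_eff p c k t)).
Proof.
move=> T0 _ [/ode_mcont cP_ _] _ [/ode_mcont cPx_ _] _ [/ode_mcont cGG_ _] [/ode_mcont cPhi_ _].
move=> oPhix oPsi bW0 bWobs indep obs t0 tS tk tauT pS pee peff.
have tT : t k <= T by rewrite tk ltW.
pose E := col3 e0 (\mxcol_(i < q) eobs i) ebar.
have errorE u w : (u^T *m (profile_mle p c k t (fun s => X (t s) w) - col_mx e0 ebar)) 0 0 =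
    \sum_(s < k) (error_weight p c k t u s *m
      noise p c E (t s) (t s.+1) (X (t s) w) (X (t s.+1) w)) 0 0.
  by rewrite (estimation_errorE pS pee peff _ _ (\mxcol_(i < q) eobs i)) col_mxKu col_mxKd.
split=> [i|u B mB].
  (* A coordinate of the error is the functional given by a basis vector, so [errorE] also yields
     its measurability. *)
  rewrite (_ : (fun w => _) = (fun w => \sum_(s < k) (error_weight p c k t (delta_mx i 0) s *m
      noise p c E (t s) (t s.+1) (X (t s) w) (X (t s.+1) w)) 0 0)); last first.
    by apply/funext => w; rewrite -errorE trmx_delta -rowE [RHS]mxE.
  by apply: measurable_sum => s; refine (noise_measurable obs t0 tT tS _ (ltn_ord s)).
rewrite mulmx0 [X in normal_law X _ _]mxE -(error_variance pS pee peff).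
rewrite -(sample_noise_law T0 cP_ cPx_ cGG_ cPhi_ oPhix oPsi bW0 bWobs indep obs t0 tT tS)//.
by congr (Pr _); apply/seteqP; split=> w /=; rewrite errorE.
Qed.
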